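(* If $X$ is an abelian group, then: (1) each maximal subgroup of the minimal ideal of $\lambda(X)$ is algebraically isomorphic to $\prod_{1\le k\le\infty}C_{2^k}^{\,q(X,C_{2^k})}$; (2) each minimal left ideal of $\lambda(X)$ is homeomorphic to the Cantor cube $(2^\omega)^{q(X,C_{2^\infty})}\times\prod_{1\le k<\infty}(2^{2^{k-1}})^{q(X,C_{2^k})}$ and is algebraically isomorphic to the semigroup $$\prod_{1\le k\le\infty}(C_{2^k}\times Z_k)^{q(X,C_{2^k})},$$ where the cube $Z_k=2^{2^{k-1}-k}$ (equal to $2^\omega$ if $k=\infty$) is endowed with the left zero multiplication; (3) the semigroup $\lambda(X)$ contains a principal left ideal which is algebraically isomorphic to the semigroup $$\prod_{1\le k\le\infty}(C_{2^k}\wr Z_k^{Z_k})^{q(X,C_{2^k})}.$$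
   Context: Superextension. $\mathsf P(X)$ is the power-set of $X$. A family $\mathcal L\subset\mathsf P(X)$ is linked if $A\cap B\ne\emptyset$ for all $A,B\in\mathcal L$, and maximal linked if it is linked and coincides with every linked family containing it. $\lambda(X)\subset\mathsf P(\mathsf P(X))$ is the set of maximal linked systems on $X$, with the subspace topology of $\mathsf P(\mathsf P(X))\cong\{0,1\}^{\mathsf P(X)}$ and the operation $\mathcal A\circ\mathcal B=\{A\subset X:\{x\in X:x^{-1}A\in\mathcal B\}\in\mathcal A\}$; it is a compact Hausdorff right-topological semigroup. The minimal ideal is the smallest two-sided ideal (the union of all minimal left ideals); its maximal subgroups are the largest subgroups containing its idempotents. A principal left ideal of a semigroup $S$ is a set $Sx$, $x\in S$. ''Algebraically isomorphic'' means semigroup-isomorphic. Left zero multiplication is $xy=x$. For a cardinal $\kappa$, $2^\kappa=\{0,1\}^\kappa$ is the cube with the product topology. Numbers $q(X,C_{2^k})$. A nonempty subset $K\subset X$ is a 2-cogroup if for every $x\in K$ the shift $xK=Kx$ is a subgroup of $X$ disjoint from $K$; then $KK$ is a subgroup. For a maximal (under inclusion) 2-cogroup $K$ let $\mathrm{Stab}(K)=\{x:xKx^{-1}=K\}$, $\mathsf H(K)=\mathrm{Stab}(K)/KK$, and $[K]=\{xKx^{-1}:x\in X\}$; $q(X,G)$ is the number (cardinal) of classes $[K]$ of maximal 2-cogroups with $\mathsf H(K)\cong G$. (For abelian $X$, $[K]=\{K\}$ and $\mathsf H(K)=X/KK$.) Here $C_{2^k}=\{z\in\mathbb C:z^{2^k}=1\}$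 for finite $k$ and $C_{2^\infty}=\bigcup_{k\ge1}C_{2^k}$. Wreath product. For a group $H$ and a set $A$, $A^A$ is the semigroup of all self-maps of $A$ under composition, and $H\wr A^A$ is the set $H^A\times A^A$ with operation $(h,f)*(h',f')=(h'',f\circ f')$, $h''(\alpha)=h(f'(\alpha))\cdot h'(\alpha)$ for $\alpha\in A$. *)

(* Defs.v *)
From HB Require Import structures.
From mathcomp Require Import all_boot all_order all_algebra.
From mathcomp Require Import all_classical all_reals all_analysis.
From mathcomp Require Import complex.

Set Implicit Arguments.
Unset Strict Implicit.
Unset Printing Implicit Defensive.

Import GRing.Theory.

Local Open Scope classical_set_scope.
Local Open Scope group_scope.

(* "Algebraically isomorphic": [A] and [B] are subsets of magmas, closed under
   multiplication wherever this is used. *)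
Definition isomorphic (S T : magmaType) (A : set S) (B : set T) :=
  exists f : S -> T,
    set_bij A B f /\ forall x y, A x -> A y -> f (x * y) = f x * f y.

Section Ideals.
Variable S : semigroupType.
Implicit Types (I J M G : set S) (x : S).

Definition left_ideal I := I !=set0 /\ forall s x, I x -> I (s * x).

Definition minimal_left_ideal I :=
  left_ideal I /\ forall J, left_ideal J -> J `<=` I -> J = I.

Definition principal_left_ideal x : set S := [set s * x | s in [set: S]].

Definition ideal I := I !=set0 /\ forall s x, I x -> I (s * x) /\ I (x * s).

Definition minimal_ideal M := ideal M /\ forall I, ideal I -> M `<=` I.

Definition group_with_identity (e : S) G :=
  [/\ G e,
      forall x y, G x -> G y -> G (x * y),
      forall x, G x -> e * x = x /\ x * e = x &
      forall x, G x -> exists y, [/\ G y, x * y = e & y * x = e]].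

Definition subgroup G := exists e, group_with_identity e G.

(* A maximal subgroup of [M] is the largest subgroup of [M] that contains a
   given idempotent of [M]. *)
Definition maximal_subgroup M G :=
  exists e, [/\ M e, e * e = e,
    [/\ subgroup G, G `<=` M & G e] &
    forall G', subgroup G' -> G' `<=` M -> G' e -> G' `<=` G].

End Ideals.

Definition sgprod (I : Type) (S : I -> semigroupType) : Type := forall i, S i.

Section SgProd.
Variables (I : Type) (S : I -> semigroupType).
HB.instance Definition _ := Choice.copy (sgprod S) (forall i, S i).
Definition sgprod_mul (f g : sgprod S) : sgprod S := fun i => f i * g i.
Fact sgprod_mulA : associative sgprod_mul.
Proof. by move=> f g h; apply: functional_extensionality_dep => i; exact: mulgA. Qed.
HB.instance Definition _ := isSemigroup.Build (sgprod S) sgprod_mulA.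
End SgProd.

Definition left_zero_sg (T : Type) : Type := T.

Section LeftZero.
Variable T : choiceType.
HB.instance Definition _ := Choice.copy (left_zero_sg T) T.
Definition left_zero_sg_mul (x y : left_zero_sg T) : left_zero_sg T := x.
Fact left_zero_sg_mulA : associative left_zero_sg_mul.
Proof. by []. Qed.
HB.instance Definition _ := isSemigroup.Build (left_zero_sg T) left_zero_sg_mulA.
End LeftZero.

Definition wreath (H A : Type) : Type := ((A -> H) * (A -> A))%type.

Section Wreath.
Variables (H : groupType) (A : choiceType).
HB.instance Definition _ := Choice.copy (wreath H A) ((A -> H) * (A -> A))%type.
Definition wreath_mul (u v : wreath H A) : wreath H A :=
  (fun a => u.1 (v.2 a) * v.1 a, u.2 \o v.2).
Fact wreath_mulA : associative wreath_mul.
Proof.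
move=> u v w; congr pair; apply: functional_extensionality_dep => a /=.
exact: mulgA.
Qed.
HB.instance Definition _ := isSemigroup.Build (wreath H A) wreath_mulA.
End Wreath.

(* The family of all families of subsets of [X], with the topology obtained by
   identifying it with [{0,1}^P(X)] through characteristic functions. *)
Definition families (X : Type) : Type := set (set X).

HB.instance Definition _ (X : Type) := Choice.copy (families X) (set (set X)).

Definition family_indicator (X : Type) (L : families X) :
  prod_topology (fun _ : set X => bool) := fun A => `[< L A >].

HB.instance Definition _ (X : Type) :=
  Topological.copy (families X) (initial_topology (@family_indicator X)).

Definition linked (X : Type) (L : families X) :=
  forall A B, L A -> L B -> A `&` B !=set0.

Definition maximal_linked (X : Type) (L : families X) :=
  linked L /\ forall L' : families X, linked L' -> L `<=` L' -> L' = L.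

Definition superextension (X : Type) : Type :=
  set_type [set L : families X | maximal_linked L].

HB.instance Definition _ (X : Type) := Topological.copy (superextension X)
  (set_type [set L : families X | maximal_linked L]).

Section Superextension.
Variable X : groupType.
Implicit Types (A B : families X) (S : set X) (x y : X).

Definition ltranslate x S : set X := [set x * y | y in S].

Definition families_mul A B : families X :=
  [set S | A [set x | B (ltranslate x^-1 S)]].

Fact ltranslateVE x S : ltranslate x^-1 S = [set y | S (x * y)].
Proof.
apply/seteqP; split=> [_ [y Sy <-]|y Sy] /=; first by rewrite mulgA mulgV mul1g.
by exists (x * y) => //; rewrite mulgA mulVg mul1g.
Qed.

Fact maximal_linkedP A S : maximal_linked A ->
  (forall T, A T -> S `&` T !=set0) -> A S.
Proof.
move=> [lA maxA] meetS.
have [T0 AT0] : exists T, A T.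
  apply: contrapT => nA.
  have lT : linked [set [set: X]].
    by move=> _ _ -> ->; exists 1.
  have /(maxA _ lT) A1 : A `<=` [set [set: X]].
    by move=> T AT; exfalso; apply: nA; exists T.
  by apply: nA; exists setT; rewrite -A1.
have SS : S `&` S !=set0 by have [x [Sx _]] := meetS _ AT0; exists x.
have lAS : linked (A `|` [set S] : families X).
  move=> T U [AT|->] [AU|->] //; first exact: lA.
    by rewrite setIC; exact: meetS.
  exact: meetS.
by rewrite -(maxA _ lAS) => [|T AT]; [right|left].
Qed.

Fact maximal_linked_up A S T : maximal_linked A -> A S -> S `<=` T -> A T.
Proof.
move=> mA AS sST; apply: (maximal_linkedP mA) => U AU.
by have [x [/sST Tx Ux]] := mA.1 _ _ AS AU; exists x.
Qed.

Fact maximal_linkedC A S : maximal_linked A -> ~ A S -> A (~` S).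
Proof.
move=> mA; apply: contra_notP => nAC; apply: (maximal_linkedP mA) => T AT.
apply: contrapT => dST; apply: nAC; apply: (maximal_linked_up mA AT) => x Tx Sx.
by apply: dST; exists x.
Qed.

Fact families_mul_maximal A B :
  maximal_linked A -> maximal_linked B -> maximal_linked (families_mul A B).
Proof.
move=> mA mB; have [lA _] := mA; have [lB _] := mB; split.
  move=> S T /lA AS /AS [x [/lB BS /BS]].
  rewrite !ltranslateVE => -[y [Sy Ty]].
  by exists (x * y).
move=> M lM sM; apply/seteqP; split=> // S MS.
apply: contrapT => nS.
suff /sM/(lM _ _ MS) [x [//]] : families_mul A B (~` S).
apply: maximal_linked_up mA (maximal_linkedC mA nS) _ => x /= nBx.
by have := maximal_linkedC mB nBx; rewrite !ltranslateVE.
Qed.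

Fact families_mulA : associative families_mul.
Proof.
move=> A B C; apply/funext => S; congr (A _); apply/funext => y.
rewrite /= [in RHS]ltranslateVE; congr (B _); apply/funext => x /=.
congr (C _); rewrite !ltranslateVE.
by apply/funext => z; rewrite /= mulgA.
Qed.

Definition superextension_mul (A B : superextension X) : superextension X :=
  exist _ (families_mul (val A) (val B))
    (mem_set (families_mul_maximal (set_mem (valP A)) (set_mem (valP B)))).

Fact superextension_mulA : associative superextension_mul.
Proof. by move=> A B C; apply: val_inj; exact: families_mulA. Qed.

HB.instance Definition _ :=
  isSemigroup.Build (superextension X) superextension_mulA.

End Superextension.

(* Subsets of a group with the setwise multiplication [A * B = {ab}]; this is
   the multiplication of cosets in a quotient group. *)
Definition subsets (X : Type) : Type := set X.

Section Subsets.
Variable X : groupType.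
HB.instance Definition _ := Choice.copy (subsets X) (set X).
Definition subsets_mul (A B : subsets X) : subsets X :=
  [set x * y | x in A & y in B].
Fact subsets_mulA : associative subsets_mul.
Proof.
move=> A B C; apply/seteqP; split.
  move=> _ [x Ax [_ [y By [z Cz <-]] <-]].
  by exists (x * y); [exists x => //; exists y|exists z; rewrite ?mulgA].
move=> _ [_ [x Ax [y By <-]] [z Cz <-]].
by exists x => //; exists (y * z); [exists y => //; exists z|rewrite mulgA].
Qed.
HB.instance Definition _ := isSemigroup.Build (subsets X) subsets_mulA.
End Subsets.

Section Cogroups.
Variable X : groupType.
Implicit Types (K : subsets X) (x : X).

Definition rtranslate K x : set X := [set y * x | y in K].

Definition conjugate x K : subsets X := [set x * y * x^-1 | y in K].

Definition two_cogroup K := K !=set0 /\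
  forall x, K x -> [/\ ltranslate x K = rtranslate K x,
                       group_closed (mem (ltranslate x K)) &
                       ltranslate x K `&` K = set0].

Definition maximal_two_cogroup K :=
  two_cogroup K /\ forall K', two_cogroup K' -> K `<=` K' -> K' = K.

Definition Stab K : set X := [set x | conjugate x K = K].

(* The quotient group Stab(K)/KK, as a set of cosets. *)
Definition characteristic_group K : set (subsets X) :=
  [set ltranslate x (K * K) | x in Stab K].

Definition conjugacy_class K : set (subsets X) :=
  [set conjugate x K | x in [set: X]].

(* The set of classes whose cardinal is q(X,G). Powers with exponent q(X,G) are
   products indexed by this set. *)
Definition qset (G : groupType) : set (set (subsets X)) :=
  [set conjugacy_class K | K in [set K |
     maximal_two_cogroup K /\ isomorphic (characteristic_group K) [set: G]]].

End Cogroups.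

Arguments qset X G : clear implicits.

Inductive exponent := Fin of nat | Infty.

Definition exponent_pos (k : exponent) : bool :=
  if k is Fin n then (0 < n)%N else true.

Definition exponents : Type := {k : exponent | exponent_pos k}.
Definition finite_exponents : Type := {n : nat | (0 < n)%N}.

Definition dyadic_roots (R : realType) (k : exponent) : set R[i] :=
  match k with
  | Fin n => [set z | z ^+ (2 ^ n) = 1]%R
  | Infty => \bigcup_(n in [set n | 1 <= n]%N) [set z | z ^+ (2 ^ n) = 1]%R
  end.

Definition C2 (R : realType) (k : exponent) : Type := set_type (@dyadic_roots R k).

Section DyadicGroup.
Variables (R : realType) (k : exponent).
Local Notation C := (dyadic_roots (R := R) k).
HB.instance Definition _ := Choice.copy (C2 R k) (set_type C).

Fact dyadic_roots1 : C 1%R.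
Proof. by case: k => [n|] /=; [|exists 1%N => //=]; rewrite expr1n. Qed.

Fact dyadic_rootsM z w : C z -> C w -> C (z * w)%R.
Proof.
case: k => [n|] /=; first by move=> zn wn; rewrite exprMn zn wn mulr1.
move=> [m m1 /= zm] [n n1 /= wn]; exists (m + n)%N => /=.
  by rewrite (leq_trans m1) ?leq_addr.
by rewrite exprMn expnD exprM zm mulnC exprM wn !expr1n mulr1.
Qed.

Fact dyadic_rootsV z : C z -> C z^-1%R.
Proof.
case: k => [n|] /=; first by move=> zn; rewrite exprVn zn invr1.
by move=> [n n1 /= zn]; exists n => //=; rewrite exprVn zn invr1.
Qed.

Fact dyadic_roots_neq0 z : C z -> z != 0%R.
Proof.
have two n : (z ^+ (2 ^ n) = 1 -> z != 0)%R.
  apply: contra_eq_neq => ->.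
  by rewrite expr0n expn_eq0 /= eq_sym oner_eq0.
by case: k => [n|[n _]] /=; exact: two.
Qed.

Definition C2_mul (z w : C2 R k) : C2 R k := exist _ (val z * val w)%R
  (mem_set (dyadic_rootsM (set_mem (valP z)) (set_mem (valP w)))).
Definition C2_one : C2 R k := exist _ 1%R (mem_set dyadic_roots1).
Definition C2_inv (z : C2 R k) : C2 R k :=
  exist _ (val z)^-1%R (mem_set (dyadic_rootsV (set_mem (valP z)))).

Fact C2_mulA : associative C2_mul.
Proof. by move=> x y z; apply: val_inj; exact: mulrA. Qed.
Fact C2_mul1 : left_id C2_one C2_mul.
Proof. by move=> x; apply: val_inj; exact: mul1r. Qed.
Fact C2_mulr1 : right_id C2_one C2_mul.
Proof. by move=> x; apply: val_inj; exact: mulr1. Qed.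
Fact C2_mulV : left_inverse C2_one C2_inv C2_mul.
Proof.
move=> x; apply: val_inj; apply: mulVf.
exact: dyadic_roots_neq0 (set_mem (valP x)).
Qed.
Fact C2_mulrV : right_inverse C2_one C2_inv C2_mul.
Proof.
move=> x; apply: val_inj; apply: mulfV.
exact: dyadic_roots_neq0 (set_mem (valP x)).
Qed.
HB.instance Definition _ :=
  isGroup.Build (C2 R k) C2_mulA C2_mul1 C2_mulr1 C2_mulV C2_mulrV.
End DyadicGroup.

(* The exponent 2^(k-1) - k is a natural number for every k >= 1. *)
Definition Zdim (k : exponent) : Type :=
  if k is Fin n then 'I_(2 ^ n.-1 - n) else nat.

Definition Zcube (k : exponent) : Type := Zdim k -> bool.
HB.instance Definition _ k := Choice.copy (Zcube k) (Zdim k -> bool).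

(* Product over 1 <= k <= oo of the powers S_k^(q(X,C_(2^k))). *)
Definition qpower (R : realType) (X : groupType) (S : exponent -> semigroupType) :
    semigroupType :=
  sgprod (fun k : exponents =>
    sgprod (fun _ : qset X (C2 R (val k)) => S (val k))).

Definition homeomorphic (T U : topologicalType) :=
  exists (f : T -> U) (g : U -> T),
    [/\ cancel f g, cancel g f, continuous f & continuous g].

Definition qcube (R : realType) (X : groupType) : topologicalType :=
  (prod_topology (fun _ : qset X (C2 R Infty) => cantor_space) *
   prod_topology (fun k : finite_exponents =>
     prod_topology (fun _ : qset X (C2 R (Fin (val k))) =>
       prod_topology (fun _ : 'I_(2 ^ (val k).-1) => bool))))%type.

(* Main.v *)
Require Import Defs.
From HB Require Import structures.
From mathcomp Require Import all_boot all_order all_algebra.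
From mathcomp Require Import all_classical all_reals all_analysis.
From mathcomp Require Import complex.

(* A maximal linked system [u] is determined by the map [A |-> {x | x^-1 A in u}],
   and the product becomes composition; the maps obtained are those that are
   monotone and commute with translations and complements. Call [A] a twin if some
   translate of [A] is its complement. By Zorn's lemma there is a maximal
   translation-invariant linked family; as [X] is abelian, every set that is not a
   twin belongs to it or has its complement in it, while inclusions between twins
   are trivial. Sending the first kind of sets to [X] or to the empty set, and each
   twin equivariantly to a twin whose stabilizer up to complement is a maximal
   2-cogroup [K], gives an idempotent [e] of the superextension, and the left ideal
   it generates consists of all equivariant maps of the twins of these maximal
   types. For fixed [K] the group [X/KK] is some [C_(2^k)], acting freely on these
   twins, which correspond to the functions [C_(2^k) -> {0,1}] with
   [F (-c) = 1 - F c]; counting orbits gives the cube [Z_k], hence the wreath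
   products. Following [e] by a map onto a single orbit for each [K] gives minimal
   left ideals. *)

Set Implicit Arguments.
Unset Strict Implicit.
Unset Printing Implicit Defensive.

Import GRing.Theory Num.Theory.

Local Open Scope classical_set_scope.
Local Open Scope group_scope.

(** * Superextensions as equivariant maps *)

(** The groups [C_(2^k)] appear because maximality is a torsion condition: if [x] is outside [KK]
    and no power of [x] lies in [K], then [K] times the powers of [x] is a larger 2-cogroup. Hence
    [X/KK] is a 2-group whose only element of order 2 is the class [K], and such an abelian group is
    some [C_(2^k)], [k] finite or infinite. The exponent [2^(k-1) - k] reflects a quotient of
    cardinalities: [2^(2^(k-1))] odd functions, [2^k] in each free orbit. For infinite [k] there is
    no such count, and an explicit family of inequivalent odd functions has to produce a continuum
    of orbits. A minimal left ideal is not assumed to lie in the one generated by [e]. Instead the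
    coordinates of the twins are changed: some idempotent of the ideal collapses each block to one
    orbit, and positions in the other orbits are measured by their images. Minimal left ideals and
    their idempotents thus come from coordinates, without an appeal to compactness. *)

Section Shifts.
Variable X : groupType.
Implicit Types (A B : set X) (x y : X) (u v : superextension X).

(* [shift x A] is [x^-1 A]. *)
Definition shift x A : set X := [set y | A (x * y)].

Lemma shift1 A : shift 1 A = A.
Proof. by apply/funext => y; rewrite /shift /= mul1g. Qed.

Lemma shiftM x y A : shift x (shift y A) = shift (y * x) A.
Proof. by apply/funext => z; rewrite /shift /= mulgA. Qed.

Lemma shiftC x A : shift x (~` A) = ~` shift x A.
Proof. by []. Qed.

Lemma shiftS x A B : A `<=` B -> shift x A `<=` shift x B.
Proof. by move=> AB y /AB. Qed.

Lemma shift_inj x : injective (shift x).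
Proof. by move=> A B /(congr1 (shift x^-1)); rewrite !shiftM !mulgV !shift1. Qed.

Definition action u A : set X := [set x | val u (shift x A)].

(* By [action_surj], these are exactly the maps [action u]. *)
Definition natural (f : set X -> set X) :=
  [/\ forall x A, f (shift x A) = shift x (f A),
      forall A, f (~` A) = ~` f A &
      forall A B, A `<=` B -> f A `<=` f B].

Lemma valE u A : val u A = action u A 1.
Proof. by rewrite /action /= shift1. Qed.

Lemma action_inj : injective action.
Proof. by move=> u v uv; apply/val_inj/funext => A; rewrite !valE uv. Qed.

Lemma actionM u v A : action (u * v) A = action u (action v A).
Proof.
apply/funext => x; rewrite /action /=; congr (val u _).
by apply/funext => y; rewrite /= /shift /= ltranslateVE; congr (val v _);
  apply/funext => z /=; rewrite mulgA.
Qed.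

Lemma superextension_maximal u : maximal_linked (val u).
Proof. exact: set_mem (valP u). Qed.

Lemma action_natural u : natural (action u).
Proof.
have mu := superextension_maximal u; split=> [x A|A|A B AB x].
- by apply/funext => y; rewrite /action /= shiftM.
- apply/seteqP; split=> x /=; last exact: maximal_linkedC mu.
  by move=> uAC uA; have [y []] := mu.1 _ _ uA uAC.
- by move=> uA; apply: maximal_linked_up mu uA _ => y; exact: AB.
Qed.

(** The system is read off at the identity, as the sets [A] with [1] in [f A]. Disjoint [A], [B]
    give [A] inside the complement of [B], so monotonicity yields linkedness; maximality holds
    because [f] decides between each set and its complement. *)
Lemma action_surj f : natural f -> exists u, action u = f.
Proof.
move=> [fS fC fU]; pose L : families X := [set A | f A 1].
have mL : maximal_linked L.
  split=> [A B fA fB|M lM LM].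
    apply: contrapT => AB; have /fU/(_ _ fA) : A `<=` ~` B.
      by move=> x Ax Bx; apply: AB; exists x.
    by rewrite fC.
  apply/seteqP; split=> // A MA; apply: contrapT => nfA.
  have : L (~` A) by rewrite /L /= fC.
  by move=> /LM /(lM _ _ MA) [x []].
exists (exist _ L (mem_set mL)); apply/funext => A; apply/funext => x.
have -> : action (exist _ L (mem_set mL)) A x = f (shift x A) 1 by [].
by rewrite fS /shift /= mulg1.
Qed.

Lemma natural0 f : natural f -> f set0 = set0.
Proof.
move=> [_ fC fU]; rewrite -subset0 => x fx.
have : f (~` set0) x by apply: fU fx.
by rewrite fC.
Qed.

Lemma naturalT f : natural f -> f setT = setT.
Proof. by move=> nf; have [_ fC _] := nf; rewrite -setC0 fC natural0. Qed.

End Shifts.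

(** * Twins and maximal invariant linked families *)

Section Twins.
Variable X : groupType.
Hypothesis abelianX : forall x y : X, commute x y.
Implicit Types (A B : set X) (x y : X).

Definition twin A := exists x, shift x A = ~` A.

Lemma shiftAC x y A : shift x (shift y A) = shift y (shift x A).
Proof. by rewrite !shiftM abelianX. Qed.

(** Complementing reverses inclusions: with [w = x * y^-1], [B] lies in the [w]-shift of [A], hence
    of [B]; shifting this by [y], which complements [B], gives the opposite inclusion. *)
Lemma twin_antichain A B : twin A -> twin B -> A `<=` B -> A = B.
Proof.
move=> [x xA] [y yB] AB; pose w := x * y^-1.
have BA : B `<=` shift w A.
  rewrite -shiftM xA -[X in X `<=` _](shift1 B) -(mulgV y) -shiftM yB.
  by rewrite -setCS in AB; exact: shiftS.
have wB : shift w B `<=` B.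
  have /(@shiftS _ y) : B `<=` shift w B
    by exact: subset_trans BA (@shiftS _ _ _ _ AB).
  by rewrite shiftAC yB shiftC setCS.
apply: (@shift_inj _ w); apply/seteqP; split; first exact: shiftS.
by move=> t /wB /BA.
Qed.

(** If [t] and [x * t] were both outside [A], the covering would put [y * t] and [y * x * t] in [A],
    and by commutativity [x] carries the first to the second. *)
Lemma pretwin_twin x y A :
  shift x A `&` A = set0 -> A `|` shift y A = setT -> twin A.
Proof.
move=> dA cA; exists x; apply/seteqP; split=> t.
  by move=> xAt At; have : set0 t by rewrite -dA.
have cov s : A s \/ A (y * s) by have : setT s by []; rewrite -cA.
move=> /= nAt; have [//|Ayxt] := cov (x * t); exfalso.
have [//|Ayt] := cov t; suff : set0 (y * t) by [].
by rewrite -dA; split=> //; rewrite /shift /= mulgA [x * y]abelianX -mulgA.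
Qed.

Definition invariant (L : families X) := forall x A, L A -> L (shift x A).

(** To a maximal invariant linked family one can adjoin the whole orbit of a set that meets its
    translates and all members. So if neither [A] nor its complement belongs, each is disjoint from
    one of its translates, which is what [pretwin_twin] asks for. *)
Lemma invariant_linked_max : exists L : families X,
  [/\ linked L, invariant L, forall A B, L A -> A `<=` B -> L B &
      forall A, ~ L A -> ~ L (~` A) -> twin A].
Proof.
have [|L [[lL iL] maxL]] :=
    @Zorn_bigcup _ [set L : families X | linked L /\ invariant L].
  move=> F FP tF; split=> [A B [L FL LA] [M FM MB]|x A [L FL LA]].
    have [LM|ML] := tF _ _ FL FM; first exact: (FP _ FM).1 (LM _ LA) MB.
    exact: (FP _ FL).1 LA (ML _ MB).
  by exists L => //; apply: (FP _ FL).2.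
have addL A : (forall x, shift x A `&` A !=set0) ->
    (forall B, L B -> B `&` A !=set0) -> L A.
  move=> sA BA; apply: contrapT => nLA.
  pose M : families X := L `|` [set shift x A | x in [set: X]].
  have LB x B : L B -> B `&` shift x A !=set0.
    move=> /(iL x^-1) /BA [t [Bt At]]; exists (x^-1 * t); split=> //.
    by rewrite /shift /= mulVKg.
  apply: (maxL M); first split=> [B LB'|ML]; first by left.
    by apply: nLA; apply: ML; right; exists 1; rewrite ?shift1.
  split=> [B C|x B].
    move=> [lB|[x _ <-]] [lC|[y _ <-]].
    - exact: lL.
    - exact: LB.
    - by rewrite setIC; exact: LB.
    - have [t [xyt At]] := sA (y^-1 * x); exists (y^-1 * t); split.
        by move: xyt; rewrite /shift /= -mulgA [x * _]abelianX -!mulgA [t * x]abelianX.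
      by rewrite /shift /= mulVKg.
  move=> [lB|[y _ <-]]; first by left; exact: iL.
  by right; exists (y * x); rewrite ?shiftM.
have up A B : L A -> A `<=` B -> L B.
  move=> LA AB; apply: addL => [x|C LC].
    by have [t [xAt At]] := lL _ _ (iL x _ LA) LA; exists t; split; apply: AB.
  by have [t [Ct At]] := lL _ _ LC LA; exists t; split=> //; apply: AB.
(* If [A] misses a member [B], then [B] lies in the complement of [A], which is then in [L]; so only
   a disjoint translate can keep [A] out. *)
have dich A : ~ L A -> ~ L (~` A) -> exists x, shift x A `&` A = set0.
  move=> nLA nLA'; apply: contrapT => nx; apply: nLA; apply: addL => [x|B LB].
    by apply/set0P/eqP => xA; apply: nx; exists x.
  apply/set0P/eqP => BA; apply: nLA'; apply: up LB _ => t Bt At.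
  by have : set0 t by rewrite -BA.
exists L; split=> // A nA nA'.
have [x xA] := dich _ nA nA'; have [|y yA] := dich _ nA'; first by rewrite setCK.
apply: (pretwin_twin xA (y := y)).
by rewrite -[LHS]setCK setCU -shiftC setIC yA setC0.
Qed.

End Twins.

(** * The groups of dyadic roots of unity *)

Section DyadicRoots.
Variable R : realType.
Implicit Types (n m : nat).

(** A coherent system of roots: starting from [zeta 1 = -1], each is a square root of the preceding
    one, so exponents at different levels can be compared. *)
Definition zeta n : R[i] := if n is m.+1 then iter m sqrtC (-1)%R else 1%R.

Lemma zetaS n : (zeta n.+1 ^+ 2 = zeta n)%R.
Proof. by case: n => [|n]; rewrite /= ?sqrrN ?expr1n ?sqrtCK. Qed.

Lemma zetaX n m : (zeta (n + m) ^+ (2 ^ m) = zeta n)%R.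
Proof.
elim: m => [|m IH]; first by rewrite addn0 expr1.
by rewrite addnS expnS exprM zetaS.
Qed.

Lemma negC1_neq1 : (-1 != 1 :> R[i])%R.
Proof. by rewrite eq_sym -subr_eq0 opprK paddr_eq0 ?ler01 // oner_eq0. Qed.

Lemma zeta_prim n : ((2 ^ n).-primitive_root (zeta n))%R.
Proof.
have z1 : (zeta n ^+ (2 ^ n) = 1)%R by rewrite -[in zeta _](add0n n) zetaX.
have [m pm] := prim_order_exists (expn_gt0 2 n) z1.
move=> /(dvdn_pfactor _ _ (isT : prime 2)) [j jn mE].
move: jn; rewrite leq_eqVlt => /predU1P [jE|jn]; first by rewrite -[in (2 ^ _)%N]jE -mE.
case: n jn {z1} pm => // n; rewrite ltnS => jn pm.
have : (zeta n.+1 ^+ (2 ^ n) = 1)%R.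
  by apply/eqP; rewrite -(prim_order_dvd pm) mE dvdn_exp2l.
by rewrite -add1n zetaX => /eqP; rewrite (negPf negC1_neq1).
Qed.

Lemma zeta_dyadic (k : exponent) n :
  (if k is Fin N then n <= N else true)%N -> dyadic_roots k (zeta n).
Proof.
have zn m : (n <= m)%N -> (zeta n ^+ (2 ^ m) = 1)%R.
  by move=> nm; apply/eqP; rewrite -(prim_order_dvd (zeta_prim n)) dvdn_exp2l.
(* The union defining the infinite group starts at exponent 1; [n.+1] also covers [n = 0]. *)
by case: k => [N /zn|_] //; exists n.+1 => //; apply: zn.
Qed.

Variable k : exponents.
Local Notation C := (C2 R (val k)).
Implicit Types (c d : C).

Lemma C2M c d : val (c * d) = (val c * val d)%R. Proof. by []. Qed.

Lemma C2X c n : val (c ^+ n) = (val c ^+ n)%R.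
Proof. by elim: n => // n IH; rewrite exprS -IH -C2M expgS. Qed.

Lemma C2_comm c d : c * d = d * c.
Proof. by apply: val_inj; rewrite !C2M mulrC. Qed.

Lemma C2_ofP (z : R[i]) : dyadic_roots (val k) z -> exists c, val c = z.
Proof. by move=> kz; exists (exist _ z (mem_set kz)). Qed.

Fact dyadicN1 : dyadic_roots (val k) (-1 : R[i])%R.
Proof.
case: k => -[N|] /= k0; last by exists 1%N => //=; rewrite sqrrN expr1n.
by rewrite -(prednK k0) expnS exprM sqrrN expr1n expr1n.
Qed.

Definition C2N1 : C := exist _ (-1)%R (mem_set dyadicN1).

Lemma C2N1_neq1 : C2N1 <> 1.
Proof. by move=> /(congr1 val) /eqP; rewrite (negPf negC1_neq1). Qed.

Lemma C2N1K c : C2N1 * (C2N1 * c) = c.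
Proof. by apply: val_inj; rewrite !C2M !mulN1r opprK. Qed.

Lemma C2N1_neq c : C2N1 * c <> c.
Proof. by move=> /(canRL (mulgK _)); rewrite mulgV; exact: C2N1_neq1. Qed.

Lemma C2_sq1 c : c * c = 1 -> c = 1 \/ c = C2N1.
Proof.
move=> /(congr1 val) /eqP; rewrite C2M -expr2 sqrf_eq1.
by move=> /orP [] /eqP cE; [left|right]; apply: val_inj.
Qed.

Lemma C2_dyadic c : exists n, c ^+ (2 ^ n) = 1.
Proof.
have [n cn] : exists n, (val c ^+ (2 ^ n) = 1)%R.
  case: (val k) c => [N|] c; first by exists N; exact: set_mem (valP c).
  by have [n _ cn] := set_mem (valP c); exists n.
by exists n; apply: val_inj; rewrite C2X.
Qed.

(** The last term other than 1 among the iterated squares of [c] has square 1, so it is -1. *)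
Lemma C2_neq1_exp c n : c ^+ (2 ^ n) = 1 -> c <> 1 ->
  exists2 m, (m < n)%N & c ^+ (2 ^ m) = C2N1.
Proof.
elim: n => [|n IH] in c *; first by rewrite expn0 expg1.
rewrite expnSr expgnA expg2 => /C2_sq1 [c1 /(IH _ c1) [m mn cm]|cN _].
  by exists m => //; rewrite ltnS ltnW.
by exists n.
Qed.

End DyadicRoots.

(** Serves twice for infinite [k]: to enumerate the group, and to parametrize orbit representatives,
    a subset of all functions; hence the set [B]. *)
Lemma Cantor_Bernstein_set (T U : Type) (B : set U) (f : T -> U) (g : U -> T) :
    injective f -> (forall t, B (f t)) ->
    (forall u u', B u -> B u' -> g u = g u' -> u = u') ->
  exists b : T -> U, injective b /\ forall u, B u <-> exists t, b t = u.
Proof.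
move=> fI fB gI.
have le1 : ([set: T] #<= B)%card.
  rewrite -(card_le_eql (inj_card_eq (f := f) (in2W fI))).
  by apply: subset_card_le => _ [t _ <-]; exact: fB.
have le2 : (B #<= [set: T])%card.
  rewrite -(card_le_eql (inj_card_eq (f := g) (A := B) _)).
    exact: subset_card_le.
  by move=> u u' /set_mem uB /set_mem uB'; exact: gI.
have /card_bijP [b [b' bK b'K]] := Cantor_Bernstein le1 le2.
have inT t : t \in [set: T] by rewrite in_setT.
exists (fun t => val (b (exist _ t (inT t)))); split=> [t t'|u].
  by move=> /val_inj /(can_inj bK) /(congr1 val).
split=> [uB|[t <-]]; last exact: set_mem (valP _).
exists (val (b' (exist _ u (mem_set uB)))).
rewrite [X in b X](_ : _ = b' (exist _ u (mem_set uB))); last exact: val_inj.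
by rewrite b'K.
Qed.

Section OddFunctions.
Variables (R : realType) (k : exponents).
Local Notation C := (C2 R (val k)).
Local Notation N1 := (C2N1 R k).
Implicit Types (c d : C) (F G : C -> bool).

(** Indexes the pairs {c, -c}. It is also the exponent of the corresponding factor of the Cantor
    cube, a set in a block being given by one bit per pair. *)
Definition half_index (e : exponent) : Type :=
  if e is Fin n then 'I_(2 ^ n.-1) else nat.

(* [d] enumerates a transversal of [C] modulo [{1,-1}]. *)
Lemma C2_half : exists d : half_index (val k) -> C,
  (forall c, exists i, c = d i \/ c = N1 * d i) /\
  (forall i j, d i = d j \/ d i = N1 * d j -> i = j).
Proof.
case: k => -[n|] /= k0; last first.
  set k' := exist _ _ _; pose D := C2 R Infty.
  (* The pairs {c, -c} are the fibres of squaring, which is onto here; a section of it after an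
     enumeration of the group is a transversal. *)
  have sqrtD (c : D) : exists d : D, d * d = c.
    have [|d dE] := @C2_ofP R k' (sqrtC (val c)).
      have [m m0 /= cm] := set_mem (valP c); exists m.+1 => //=.
      by rewrite expnS exprM sqrtCK.
    by exists d; apply: val_inj; rewrite (C2M (k := k')) dE -expr2 sqrtCK.
  have [sq sqE] := choice sqrtD.
  have zD n : exists c : D, val c = zeta R n by apply: (@C2_ofP R k'); exact: zeta_dyadic.
  have [z zE] := choice zD.
  have decode (c : D) : exists nj : nat * nat, c = z nj.1 ^+ nj.2.
    have [m m0 /= cm] := set_mem (valP c).
    have [j cj] := prim_rootP (zeta_prim R m) cm.
    by exists (m, val j); apply: val_inj; rewrite (C2X (k := k')) zE.
  have [code codeE] := choice decode.
  have [|//||e [eI eS]] := @Cantor_Bernstein_set nat D setT z (pickle \o code).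
  - have zI n m : z n = z m -> (m <= n)%N.
      move=> nm; rewrite -(@dvdn_Pexp2l 2) // (prim_order_dvd (zeta_prim R m)).
      rewrite -zE -nm zE; exact/eqP/prim_expr_order/zeta_prim.
    by move=> n m nm; apply/eqP; rewrite eqn_leq !zI.
  - move=> c d _ _ /(pcan_inj pickleK) cd.
    by rewrite (codeE c) (codeE d) cd.
  exists (sq \o e); split=> [c|i j ij].
    have [i ei] := (eS (c * c)).1 I; exists i => /=; rewrite ei.
    have : (c * (sq (c * c))^-1) * (c * (sq (c * c))^-1) = 1.
      rewrite -mulgA (mulgA _ c) (C2_comm (k := k') _ c) -!mulgA -invgM sqE.
      by rewrite mulgA mulgV.
    move=> /(C2_sq1 (k := k')) [/divg1_eq|/(canRL (mulgVK _))]; first by left.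
    by right.
  apply: eI; rewrite -(sqE (e i)) -(sqE (e j)).
  case: ij => /= [->|->] //; rewrite -!mulgA (C2_comm (k := k') (sq _) (_ * _)).
  by rewrite -mulgA; apply: (@C2N1K R k').
set k' := exist _ _ _; pose D := C2 R (Fin n).
have [g gE] : exists c : D, val c = zeta R n.
  by apply: (@C2_ofP R k'); apply: (@zeta_dyadic R (Fin n)) => /=.
have gX j : val (g ^+ j) = (zeta R n ^+ j)%R by rewrite (C2X (k := k')) gE.
have eqg i j : g ^+ i = g ^+ j -> i = j %[mod 2 ^ n].
  move=> /(congr1 val); rewrite !gX => /eqP.
  by rewrite (eq_prim_root_expr (zeta_prim R n)) => /eqP.
have gN : g ^+ (2 ^ n.-1) = C2N1 R k'.
  by apply: val_inj; rewrite gX /=; have := zetaX R 1 n.-1; rewrite add1n prednK.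
have n2 : (2 ^ n = 2 ^ n.-1 + 2 ^ n.-1)%N by rewrite addnn -mul2n -expnS prednK.
have lt2 (i : 'I_(2 ^ n.-1)) : (i < 2 ^ n)%N by rewrite n2 ltn_addr.
(* As [g ^+ (2 ^ n.-1)] is -1, the lower half of the exponents meets each pair once. *)
exists (fun i : 'I_(2 ^ n.-1) => g ^+ i); split=> [c|i j].
  have [j cj] := prim_rootP (zeta_prim R n) (set_mem (valP c)).
  have {}cj : c = g ^+ j by apply: val_inj; rewrite gX.
  have [jn|nj] := ltnP j (2 ^ n.-1); first by exists (Ordinal jn); left.
  have jn : (j - 2 ^ n.-1 < 2 ^ n.-1)%N by rewrite ltn_subLR // -n2 ltn_ord.
  exists (Ordinal jn); right => /=.
  by rewrite -gN -expgnDr subnKC.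
case=> [/eqg|]; first by rewrite !modn_small // => /val_inj.
rewrite -gN -expgnDr => /eqg; rewrite !modn_small //; last by rewrite n2 ltn_add2l.
by move=> ij; have := ltn_ord i; rewrite ij ltnNge leq_addr.
Qed.

Lemma C2_half_coord :
  exists (d : half_index (val k) -> C) (idx : C -> half_index (val k))
         (sg : C -> bool),
  [/\ forall c, c = if sg c then N1 * d (idx c) else d (idx c),
      forall i, idx (d i) = i, forall i, sg (d i) = false,
      forall c, idx (N1 * c) = idx c & forall c, sg (N1 * c) = ~~ sg c].
Proof.
have [d [dS dI]] := C2_half.
have [idx idxE] := choice dS.
pose sg c := c != d (idx c).
have sgE c : c = if sg c then N1 * d (idx c) else d (idx c).
  rewrite /sg; case: eqVneq => // cd.
  by case: (idxE c) => // cE; rewrite -cE eqxx in cd.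
have idxd i : idx (d i) = i by apply/esym/dI; exact: idxE.
have idxN c : idx (N1 * c) = idx c.
  apply: dI; case: (idxE (N1 * c)) => [e1|/mulgI e1]; case: (idxE c) => e2.
  - by right; rewrite -e1 -e2.
  - by left; rewrite -e1 {1}e2 C2N1K.
  - by left; rewrite -e1 -e2.
  - by right; rewrite -e1 -e2.
exists d, idx, sg; split=> // [i|c]; first by rewrite /sg idxd eqxx.
rewrite /sg idxN negbK; case: (idxE c) => cE.
  by rewrite -cE eqxx; apply/eqP; exact: C2N1_neq.
have -> : d (idx c) = N1 * c by rewrite [in RHS]cE C2N1K.
by rewrite eqxx; apply/esym/negbTE/eqP => /esym; exact: C2N1_neq.
Qed.

End OddFunctions.

(** * Odd functions on a dyadic group *)

Section OddOrbits.
Variables (R : realType) (k : exponents).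
Local Notation C := (C2 R (val k)).
Local Notation N1 := (C2N1 R k).
Implicit Types (c d : C) (F G : C -> bool).

Definition odd_fun F := forall c, F (N1 * c) = ~~ F c.

Definition translate c F : C -> bool := fun d => F (c * d).

Lemma translate1 F : translate 1 F = F.
Proof. by apply/funext => d; rewrite /translate mul1g. Qed.

Lemma translateM c d F : translate c (translate d F) = translate (d * c) F.
Proof. by apply/funext => e; rewrite /translate mulgA. Qed.

Lemma translate_odd c F : odd_fun F -> odd_fun (translate c F).
Proof. by move=> oF d; rewrite /translate mulgA (C2_comm c N1) -mulgA oF. Qed.

Lemma translateX c F n : translate c F = F -> translate (c ^+ n) F = F.
Proof.
by move=> cF; elim: n => [|n IH]; rewrite ?expg0 ?translate1 // expgS -translateM cF.
Qed.

(** If [c] is not 1, some power of it is -1; that power would also fix [F], against oddness. *)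
Lemma translate_free c F : odd_fun F -> translate c F = F -> c = 1.
Proof.
move=> oF cF; apply: contrapT => c1.
have [n cn] := C2_dyadic c; have [m _ cm] := C2_neq1_exp cn c1.
have /(congr1 (@^~ 1)) := translateX (2 ^ m) cF.
by rewrite cm /translate oF; case: (F 1).
Qed.

(** The choice is made from the orbit as a set, hence is the same for all its members. *)
Definition orbit_rep F : C -> bool :=
  xget (fun=> true) [set G | exists c, G = translate c F].

Lemma orbit_repP F : exists c, orbit_rep F = translate c F.
Proof.
have [|c] := @xgetPex _ (fun=> true) [set G | exists c, G = translate c F].
  by exists F, 1; rewrite translate1.
by exists c.
Qed.

Lemma orbit_rep_translate c F : orbit_rep (translate c F) = orbit_rep F.
Proof.
congr xget; apply/seteqP; split=> _ [d ->]; first by exists (c * d); rewrite translateM.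
by exists (c^-1 * d); rewrite translateM mulVKg.
Qed.

(** The values on the transversal are free, and adding the sign modulo 2 extends them oddly. *)
Lemma odd_half_bij : exists f : (half_index (val k) -> bool) -> (C -> bool),
  [/\ injective f, forall v, odd_fun (f v) & forall F, odd_fun F -> exists v, f v = F].
Proof.
have [d [idx [sg [cE idxd sgd idxN sgN]]]] := C2_half_coord R k.
exists (fun v c => v (idx c) (+) sg c); split=> [v w vw|v c|F oF].
- apply/funext => i; have := congr1 (@^~ (d i)) vw.
  by rewrite idxd sgd !addbF.
- by rewrite idxN sgN addbN.
- exists (F \o d); apply/funext => c /=; rewrite [in RHS](cE c).
  by case: (sg c); rewrite ?oF ?addbT ?addbF.
Qed.

End OddOrbits.

(** Ensures that the truncated subtraction in [Zdim] is a true one. *)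
Lemma expn_pred_ge n : (0 < n -> n <= 2 ^ n.-1)%N.
Proof. by case: n => // n _; exact: ltn_expl. Qed.

Section FiniteOrbits.
Variables (R : realType) (n : nat) (n0 : exponent_pos (Fin n)).
Local Notation k := (exist (fun k => is_true (exponent_pos k)) (Fin n) n0 : exponents).
Local Notation C := (C2 R (val k)).

(** A group of order [2 ^ n] acts freely on [2 ^ m] odd functions, where [m = 2 ^ n.-1]; so there
    are [2 ^ (m - n)] orbits, as many as points of [Zcube]. *)
Lemma finite_orbits : exists b : Zcube (val k) -> (C -> bool),
  injective b /\ forall F, (@odd_fun R k F /\ orbit_rep F = F) <-> exists z, b z = F.
Proof.
have [f [fI fO fS]] := odd_half_bij R k.
pose m := (2 ^ n.-1)%N; pose V := {ffun 'I_m -> bool}.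
have fvI (v w : V) : f v = f w -> v = w.
  move=> /fI vw; apply/ffunP => i; exact: (congr1 (fun u : 'I_m -> bool => u i) vw).
have fvS F : @odd_fun R k F -> exists v : V, f v = F.
  by move=> /fS [v <-]; exists (finfun v); congr f; apply/funext => i; rewrite ffunE.
have [g gE] : exists c : C, val c = zeta R n.
  by apply: C2_ofP; apply: (@zeta_dyadic R (Fin n)) => /=.
have gX j : val (g ^+ j) = (zeta R n ^+ j)%R by rewrite C2X gE.
have gS (c : C) : exists j : 'I_(2 ^ n), c = g ^+ j.
  have [j cj] := prim_rootP (zeta_prim R n) (set_mem (valP c)).
  by exists j; apply: val_inj; rewrite gX.
have gI (i j : 'I_(2 ^ n)) : g ^+ i = g ^+ j -> i = j.
  move=> /(congr1 val); rewrite !gX => /eqP.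
  by rewrite (eq_prim_root_expr (zeta_prim R n)) !modn_small // => /eqP /val_inj.
pose P := [set v : V | `[< orbit_rep (f v) = f v >]]%SET.
have PE v : (v \in P) = `[< orbit_rep (f v) = f v >] by rewrite inE.
(* [h] translates the representative [v] by [g ^+ i]. Freeness makes it injective, and every odd
   function is a translate of its representative. *)
have [h hE] := choice (fun iv : 'I_(2 ^ n) * V =>
  fvS _ (translate_odd (g ^+ iv.1) (fO iv.2))).
have hI : {in finset.setX [set: 'I_(2 ^ n)]%SET P &, injective h}.
  move=> [i v] [j w]; rewrite !finset.in_setX /= !finset.in_setT /= !PE.
  move=> /asboolP vP /asboolP wP /(congr1 (fun u : V => f u)); rewrite !hE /= => ij.
  have vw : v = w.
    by apply: fvI; rewrite -vP -wP -(orbit_rep_translate (g ^+ i)) ij orbit_rep_translate.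
  move: ij; rewrite vw => /(congr1 (translate (g ^+ j)^-1)).
  rewrite !translateM mulgV translate1 => /(translate_free (fO _)) /divg1_eq /gI ->.
  by [].
have hS : h @: finset.setX [set: 'I_(2 ^ n)]%SET P = [set: V]%SET.
  apply/finset.setP => v; rewrite finset.in_setT; apply/imsetP.
  have [c cE] := orbit_repP (f v); have [i iE] := gS c^-1.
  have [w wE] := fvS _ (translate_odd c (fO v)).
  exists (i, w); last first.
    by apply: fvI; rewrite hE /= wE -iE translateM mulgV translate1.
  rewrite finset.in_setX /= finset.in_setT PE wE; apply/asboolP.
  by rewrite orbit_rep_translate.
have cardP : #|P| = (2 ^ (m - n))%N.
  have := card_in_imset hI; rewrite hS finset.cardsT card_ffun card_bool card_ord.
  rewrite cardsX finset.cardsT card_ord => /eqP.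
  have mE : (m = n + (m - n))%N by rewrite subnKC //; exact: expn_pred_ge.
  by rewrite {1}mE expnD eqn_pmul2l ?expn_gt0 // => /eqP ->.
pose Z := {ffun 'I_(m - n) -> bool}.
have cardZ : #|Z| = #|P| by rewrite card_ffun card_bool card_ord cardP.
pose b (z : Zcube (val k)) : C -> bool :=
  f (enum_val (cast_ord cardZ (enum_rank (finfun z : Z)))).
exists b; split=> [z w /fvI|F].
  move=> /enum_val_inj /cast_ord_inj /enum_rank_inj zw.
  by apply/funext => i; have := congr1 (fun u : Z => u i) zw; rewrite !ffunE.
split=> [[/fvS [v <-] vP]|[z <-]].
  have {}vP : v \in P by rewrite PE; apply/asboolP.
  exists (enum_val (cast_ord (esym cardZ) (enum_rank_in vP v)) : Z).
  rewrite /b (_ : finfun _ = enum_val (cast_ord (esym cardZ) (enum_rank_in vP v))).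
    by rewrite enum_valK cast_ordKV enum_rankK_in.
  by apply/ffunP => i; rewrite ffunE.
split; first exact: fO.
by have := enum_valP (cast_ord cardZ (enum_rank (finfun z : Z))); rewrite PE => /asboolP.
Qed.

End FiniteOrbits.

Section InfiniteOrbits.
Variables (R : realType) (i0 : exponent_pos Infty).
Local Notation k := (exist (fun k => is_true (exponent_pos k)) Infty i0 : exponents).
Local Notation C := (C2 R (val k)).
Local Notation N1 := (C2N1 R k).
Implicit Types (c d : C).

Fact level_subproof c : exists n, c ^+ (2 ^ n) == 1.
Proof. by have [n cn] := C2_dyadic c; exists n; apply/eqP. Qed.

(* The order of [c] is [2 ^ level c]. *)
Definition level c := ex_minn (level_subproof c).

Lemma levelP c n : (c ^+ (2 ^ n) == 1) = (level c <= n)%N.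
Proof.
rewrite /level; case: ex_minnP => m /eqP cm min; apply/idP/idP => [/min //|mn].
by rewrite -(subnKC mn) expnD expgnA cm expg1n.
Qed.

Lemma C2_expMn c d n : (c * d) ^+ n = c ^+ n * d ^+ n.
Proof. by apply: expgMn; exact: C2_comm. Qed.

(** For [n] at least [level c], the factor [c] disappears from the [2 ^ n]-th power, so [c * d] and
    [d] are killed by the same such powers. *)
Lemma level_mul c d : (level c < level d)%N -> level (c * d) = level d.
Proof.
move=> cd; have le n : (level c <= n)%N -> (level (c * d)%g <= n)%N = (level d <= n)%N.
  by rewrite -!levelP C2_expMn => /eqP ->; rewrite mul1g.
apply/eqP; rewrite eqn_leq le ?(ltnW cd) // leqnn /=.
have := le (level (c * d)); rewrite leqnn => <- //.
rewrite leqNgt; apply/negP => lt; have := le (level c) (leqnn _).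
by rewrite (ltnW lt) leqNgt cd.
Qed.

Lemma level_exists n : exists c, level c = n.
Proof.
have [c cE] : exists c : C, val c = zeta R n by apply: C2_ofP; exact: (@zeta_dyadic R Infty).
exists c; have le m : (level c <= m)%N = (n <= m)%N.
  rewrite -levelP -(inj_eq val_inj) C2X cE -(prim_order_dvd (zeta_prim R n)).
  by rewrite dvdn_Pexp2l.
by apply/eqP; rewrite eqn_leq le leqnn -le leqnn.
Qed.

Lemma level_N1 c : (1 < level c)%N -> level (N1 * c) = level c.
Proof.
move=> c1; apply: level_mul; apply: leq_ltn_trans c1; rewrite -levelP.
by rewrite expn1 expg2; apply/eqP/val_inj; rewrite C2M /= mulrNN mulr1.
Qed.

(** Counting is replaced by two injections. Odd functions are coded by bit sequences on the
    countable transversal; conversely a bit sequence twists a fixed odd [F0], its [n]-th bit acting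
    on the elements of level [n + 3]. *)
Lemma infinite_orbits : exists b : Zcube (val k) -> (C -> bool),
  injective b /\ forall F, (@odd_fun R k F /\ orbit_rep F = F) <-> exists z, b z = F.
Proof.
have [f [fI fO fS]] := odd_half_bij R k.
have [F0 oF0] : exists F0, @odd_fun R k F0 by exists (f (fun=> true)); exact: fO.
(* Functions [mod_ a], [mod_ b] in the same orbit differ by a translation by
   some [c]; comparing them on the elements of a high level forces [c = 1]. *)
pose mod_ (a : nat -> bool) c := F0 c (+) ((2 < level c)%N && a (level c - 3)).
have oM a : odd_fun (mod_ a).
  move=> c; rewrite /mod_ oF0; have [c3|c2] := ltnP 2 (level c).
    by rewrite level_N1 ?c3 ?addNb // ltnW.
  rewrite (_ : (2 < level (N1 * c)%g)%N = false) ?addbF //.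
  apply: contraTF c2 => c3; rewrite -ltnNge.
  by have := level_N1 (ltnW c3); rewrite C2N1K => ->.
have modI a b c : mod_ a = translate c (mod_ b) -> a = b.
  move=> ab; have ab_ d : mod_ a d = mod_ b (c * d) by rewrite ab.
  (* The relations at [d] and at [c * d] contain the same bits, which cancel: [F0] has period
     [c * c] at high levels. A power of [c * c] equal to -1 would contradict oddness. *)
  have Fcc d : (2 < level d)%N -> (level c < level d)%N -> F0 (c * c * d) = F0 d.
    move=> d2 cd; have := ab_ d; have := ab_ (c * d).
    rewrite /mod_ mulgA.
    have l1 : level (c * d) = level d by exact: level_mul.
    have l2 : level (c * c * d) = level d by rewrite -mulgA level_mul l1.
    rewrite l1 l2 d2 /=; case: (F0 _); case: (F0 _); case: (F0 _) => /=;
      by case: (a _); case: (b _).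
  have cc1 : c * c = 1.
    have [d dE] := level_exists (maxn 3 (level c).+1).
    have d2 : (2 < level d)%N by rewrite dE leq_maxl.
    have cd : (level c < level d)%N by rewrite dE leq_maxr.
    apply: contrapT => cc; have [n cn] := C2_dyadic (c * c).
    have [m _ cm] := C2_neq1_exp cn cc.
    have Fm j : F0 ((c * c) ^+ j * d) = F0 d.
      have lc j' : (level ((c * c) ^+ j' * d)) = level d.
        elim: j' => [|j' IH]; first by rewrite expg0 mul1g.
        by rewrite expgS -!mulgA level_mul level_mul ?IH.
      elim: j => [|j IH]; first by rewrite expg0 mul1g.
      by rewrite expgS -[_ * _ * d]mulgA Fcc ?lc.
    by have := Fm (2 ^ m)%N; rewrite cm oF0; case: (F0 d).
  have [c1|cN] := C2_sq1 cc1.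
    apply/funext => n; have [d dE] := level_exists (n + 3).
    have := ab_ d; rewrite c1 mul1g /mod_ dE addnK.
    rewrite (_ : (2 < n + 3)%N = true) ?addn3 //=.
    by case: (F0 d); case: (a n); case: (b n).
  (* This is the case [c = -1]: no twist acts at level 2, where the relation contradicts the oddness
     of [F0]. *)
  have [d dE] := level_exists 2.
  have := ab_ d; rewrite cN /mod_ level_N1 dE //= !addbF oF0.
  by case: (F0 d).
have [v vE] := choice (fun a => fS _ (oM a)).
have repO F : odd_fun F -> odd_fun (orbit_rep F).
  by move=> oF; have [c ->] := orbit_repP F; exact: translate_odd.
have repK F : orbit_rep (orbit_rep F) = orbit_rep F.
  by have [c {1}->] := orbit_repP F; rewrite orbit_rep_translate.
have [decode decodeE] : {g : (C -> bool) -> (nat -> bool) |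
    forall F, odd_fun F -> f (g F) = F}.
  have /choice [g gE] F : exists w, odd_fun F -> f w = F.
    have [/fS [w <-]|nF] := pselect (odd_fun F); first by exists w.
    by exists (fun=> true).
  by exists g.
have [||F F' [oF _] [oF' _] FF'|b [bI bS]] := @Cantor_Bernstein_set (nat -> bool)
    (C -> bool) [set F | odd_fun F /\ orbit_rep F = F]
    (fun a => orbit_rep (mod_ a)) decode.
- move=> a b ab; have [c cE] := orbit_repP (mod_ a); have [d dE] := orbit_repP (mod_ b).
  apply: (modI a b (d * c^-1)); rewrite -translateM -dE -ab cE.
  by rewrite translateM mulgV translate1.
- by move=> a; split; [exact: repO | exact: repK].
- by rewrite -(decodeE _ oF) -(decodeE _ oF') FF'.
- by exists b.
Qed.

End InfiniteOrbits.

(* [p c z] runs through the odd functions: [z] labels the orbit under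
   translations, [c] the position in the orbit. *)
Lemma odd_coord (R : realType) (k : exponents) (C := C2 R (val k)) :
  exists p : C -> Zcube (val k) -> (C -> bool),
  [/\ forall c z, odd_fun (p c z),
      forall F, odd_fun F -> exists c z, F = p c z,
      forall c z c' z', p c z = p c' z' -> c = c' /\ z = z' &
      forall c z d, p c z d = p 1 z (c * d)].
Proof.
have [b [bI bP]] : exists b : Zcube (val k) -> (C -> bool),
    injective b /\ forall F, (odd_fun F /\ orbit_rep F = F) <-> exists z, b z = F.
  rewrite {}/C; case: k => -[n|] e0; [exact: finite_orbits|exact: infinite_orbits].
have bO z : odd_fun (b z) by have [] := (bP (b z)).2 (ex_intro _ z erefl).
have bR z : orbit_rep (b z) = b z by have [] := (bP (b z)).2 (ex_intro _ z erefl).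
exists (fun c z => translate c (b z)); split.
- by move=> c z; exact: translate_odd.
- move=> F oF; have [c cE] := orbit_repP F.
  have [|z zE] := (bP (orbit_rep F)).1.
    split; first by rewrite cE; exact: translate_odd.
    by rewrite {1}cE orbit_rep_translate.
  by exists c^-1, z; rewrite zE cE translateM mulgV translate1.
- move=> c z c' z' cz.
  have zz : z = z'.
    by apply: bI; rewrite -(bR z) -(orbit_rep_translate c) cz orbit_rep_translate.
  split=> //; move: cz; rewrite zz => /(congr1 (translate c'^-1)).
  by rewrite !translateM mulgV translate1 => /(translate_free (bO _)) /divg1_eq.
- by move=> c z d; rewrite /translate mul1g.
Qed.

(** * Quotients with a smallest nontrivial subgroup *)

Section QuasiCyclic.
Variables (R : realType) (X : groupType).
Hypothesis abelianX : forall x y : X, commute x y.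
Implicit Types (x y : X) (n m i j : nat).
(* [H] is a subgroup and [K] a coset of order 2 in [X/H], which is contained in
   every nontrivial subgroup of [X/H]. *)
Variables H K : set X.
Hypothesis H1 : H 1.
Hypothesis HF : forall x y, H x -> H y -> H (x / y).
Hypothesis HK : forall x y, H x -> K y -> K (x * y).
Hypothesis KK : forall x y, K x -> K y -> H (x * y).
Hypothesis HK0 : forall x, H x -> ~ K x.
Hypothesis Kne : K !=set0.
Hypothesis H2n : forall x, exists n, H (x ^+ (2 ^ n)).
Hypothesis H2 : forall x, H (x ^+ 2) -> H x \/ K x.

Definition cong x y := H (x / y).

Lemma HV x : H x -> H x^-1. Proof. by rewrite -(mul1g x^-1); exact: HF. Qed.

Lemma HM x y : H x -> H y -> H (x * y).
Proof. by move=> Hx /HV; rewrite -{2}(invgK y); exact: HF. Qed.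

Lemma HX x n : H x -> H (x ^+ n).
Proof. by move=> Hx; elim: n => [|n IH]; rewrite ?expg0 // expgS; exact: HM. Qed.

Lemma cong_refl x : cong x x. Proof. by rewrite /cong mulgV. Qed.

Lemma cong_sym x y : cong x y -> cong y x.
Proof. by move=> /HV; rewrite /cong invgF. Qed.

Lemma cong_trans y x z : cong x y -> cong y z -> cong x z.
Proof. by move=> xy /(HM xy); rewrite divgKA. Qed.

Lemma congM x y x' y' : cong x y -> cong x' y' -> cong (x * x') (y * y').
Proof.
move=> xy /(HM xy); rewrite /cong; congr (H _).
rewrite invgM [y'^-1 * y^-1]abelianX !mulgA; congr (_ * _).
by rewrite -!mulgA; congr (x * _); exact: abelianX.
Qed.

Lemma congX n x y : cong x y -> cong (x ^+ n) (y ^+ n).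
Proof.
move=> xy; elim: n => [|n IH]; first exact: cong_refl.
by rewrite !expgS; exact: congM.
Qed.

Lemma cong_H x y : cong x y -> H x -> H y.
Proof. by move=> /cong_sym xy Hx; rewrite -(mulgVK x y); exact: HM. Qed.

Lemma cong_K x y : cong x y -> K x -> K y.
Proof. by move=> /cong_sym xy Kx; rewrite -(mulgVK x y); exact: HK. Qed.

Lemma cong1 x : cong x 1 <-> H x. Proof. by rewrite /cong divg1. Qed.

Lemma KV x : K x -> K x^-1.
Proof.
move=> Kx; rewrite -(mulKg (x * x) x^-1) -mulgA mulgV mulg1.
by apply: HK => //; apply: HV; exact: KK.
Qed.

Lemma K_cong x y : K x -> K y -> cong x y.
Proof. by move=> Kx /KV; exact: KK. Qed.

Lemma KX x n : odd n -> K x -> K (x ^+ n).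
Proof.
move=> on Kx; rewrite -(odd_double_half n) on add1n expgS abelianX.
by apply: HK => //; rewrite -mul2n expgnA; apply: HX; exact: KK.
Qed.

(* [g n] behaves in [X/H] like [zeta n]. *)
Section Character.
Variable k : exponents.
Let lev n := (if val k is Fin N then n <= N else true)%N.
Local Notation C := (C2 R (val k)).
Variable g : nat -> X.
Hypothesis g0 : H (g 0).
Hypothesis g1 : K (g 1).
Hypothesis gS : forall n, lev n.+1 -> cong (g n.+1 ^+ 2) (g n).
Hypothesis gcov : forall x, exists n j, lev n /\ cong x (g n ^+ j).

Let lev_le n m : (n <= m)%N -> lev m -> lev n.
Proof. by rewrite /lev; case: (val k) => // N; exact: leq_trans. Qed.

Let lev1 : lev 1. Proof. by rewrite /lev; case: k => -[]. Qed.

Lemma gX n m : lev (n + m) -> cong (g (n + m) ^+ (2 ^ m)) (g n).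
Proof.
elim: m => [|m IH]; first by rewrite addn0 expn0 expg1 => _; exact: cong_refl.
rewrite addnS => l; rewrite expnS expgnA.
by apply: cong_trans (IH (lev_le (leqnSn _) l)); apply: congX; exact: gS.
Qed.

(** For even [j], squaring passes from [g n.+1] to [g n]. For odd [j], the [2 ^ n]-th power of
    [g n.+1 ^+ j] is congruent to an odd power of [g 1], which lies in [K], not in [H]. *)
Lemma gX_H n j : lev n -> H (g n ^+ j) <-> (2 ^ n %| j)%N.
Proof.
elim: n j => [|n IH] j l; first by rewrite expn0 dvd1n; split=> // _; exact: HX.
have [oj|ej] := boolP (odd j).
  split=> [|dj]; last first.
    by have := dvdn_trans (dvdn_exp (ltn0Sn n) (dvdnn 2)) dj; rewrite dvdn2 oj.
  move=> /(HX (2 ^ n)); rewrite expgnAC => Hg; exfalso.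
  have l1 : lev (1 + n) by rewrite add1n.
  by apply: HK0 (cong_H (congX j (gX l1)) Hg) _; exact: KX.
rewrite -(odd_double_half j) (negbTE ej) add0n -mul2n expgnA expnS dvdn_pmul2l //.
rewrite -IH ?(lev_le _ l) //; have gc := congX j./2 (gS l).
by split; apply: cong_H => //; exact: cong_sym.
Qed.

Lemma gX_cong n i j : lev n -> cong (g n ^+ i) (g n ^+ j) <-> (zeta R n ^+ i = zeta R n ^+ j)%R.
Proof.
move=> l; wlog ij : i j / (i <= j)%N.
  move=> W; have [/W //|/ltnW /W [W1 W2]] := leqP i j.
  by split=> [/cong_sym /W1 //|/esym /W2 /cong_sym].
have -> : (zeta R n ^+ i = zeta R n ^+ j)%R <-> (2 ^ n %| j - i)%N.
  rewrite -eqn_mod_dvd // eq_sym -(eq_prim_root_expr (zeta_prim R n)).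
  by split=> /eqP.
rewrite -gX_H // expgnFr //.
by split=> /cong_sym.
Qed.

(** The graph of the character sending [g n ^+ j] to [zeta n ^+ j]; a relation, because [n] and [j]
    are not unique. *)
Definition char_rel x (c : C) :=
  exists n j, [/\ lev n, cong x (g n ^+ j) & val c = (zeta R n ^+ j)%R].

(** Below [m], [g n] and [zeta n] are the same power of [g m] and [zeta m], so two elements can be
    compared at a common level. *)
Lemma char_rel_level x c : char_rel x c ->
  exists n, lev n /\ forall m, (n <= m)%N -> lev m ->
    exists j, cong x (g m ^+ j) /\ val c = (zeta R m ^+ j)%R.
Proof.
move=> [n [j [l xj cj]]]; exists n; split=> // m nm lm.
exists (2 ^ (m - n) * j)%N; split.
  apply: cong_trans xj _; rewrite expgnA; apply/congX/cong_sym.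
  by rewrite -{1}(subnKC nm); apply: gX; rewrite subnKC.
by rewrite cj exprM -{1}(subnKC nm) zetaX.
Qed.

Lemma char_rel2 x y c d : char_rel x c -> char_rel y d ->
  exists n i j, [/\ lev n, cong x (g n ^+ i), cong y (g n ^+ j),
    val c = (zeta R n ^+ i)%R & val d = (zeta R n ^+ j)%R].
Proof.
move=> /char_rel_level [n [ln xn]] /char_rel_level [m [lm ym]].
pose p := maxn n m; have lp : lev p by rewrite /p; case: (leqP n m).
have [i [xi ci]] := xn p (leq_maxl _ _) lp; have [j [yj dj]] := ym p (leq_maxr _ _) lp.
by exists p, i, j.
Qed.

Lemma char_rel_cong x y c d : char_rel x c -> char_rel y d -> cong x y <-> c = d.
Proof.
move=> xc /(char_rel2 xc) [n [i [j [l xi yj ci dj]]]].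
have <- : (zeta R n ^+ i = zeta R n ^+ j)%R <-> c = d.
  by rewrite -ci -dj; split=> [/val_inj|->].
rewrite -gX_cong //; split=> h.
  by apply: cong_trans (cong_trans h yj); exact: cong_sym.
by apply: cong_trans xi (cong_trans h _); exact: cong_sym.
Qed.

Lemma char_relM x y c d : char_rel x c -> char_rel y d -> char_rel (x * y) (c * d).
Proof.
move=> xc /(char_rel2 xc) [n [i [j [l xi yj ci dj]]]]; exists n, (i + j)%N; split=> //.
  by rewrite expgnDr; exact: congM.
by rewrite C2M ci dj exprD.
Qed.

(** [gcov] makes [char_rel] total and [char_rel_cong] makes it single-valued; [K] goes to -1 because
    it contains [g 1] and [zeta 1 = -1]. *)
Lemma char_of_seq : exists chi : X -> C,
  [/\ forall x y, chi (x * y) = chi x * chi y, forall c, exists x, chi x = c,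
     forall x, chi x = 1 <-> H x & forall x, chi x = C2N1 R k <-> K x].
Proof.
have ex x : exists c, char_rel x c.
  have [n [j [l xj]]] := gcov x.
  have [c cE] : exists c : C, val c = zeta R n by apply: C2_ofP; exact: zeta_dyadic.
  by exists (c ^+ j), n, j; split=> //; rewrite C2X cE.
have [chi chiE] := choice ex.
have uniq x c : char_rel x c -> chi x = c.
  by move=> xc; apply: (char_rel_cong (chiE x) xc).1; exact: cong_refl.
have r1 : char_rel 1 1.
  by exists 1%N, 0%N; split; rewrite ?expg0 //; exact: cong_refl.
exists chi; split=> [x y|c|x|x].
- by apply: uniq; exact: char_relM.
- have [n [l cn]] : exists n, lev n /\ (val c ^+ (2 ^ n) = 1)%R.
    rewrite /lev; case: (val k) c => [N|] c.
      by exists N; split=> //; exact: set_mem (valP c).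
    by have [n _ cn] := set_mem (valP c); exists n.
  have [j cj] := prim_rootP (zeta_prim R n) cn.
  exists (g n ^+ j); apply: uniq; exists n, j; split=> //; exact: cong_refl.
- have xr := char_rel_cong (chiE x) r1.
  by split=> [/xr.2/cong1|/cong1/xr.1].
- have rN : char_rel (g 1) (C2N1 R k).
    by exists 1%N, 1%N; split; rewrite ?expg1 //; exact: cong_refl.
  have xr := char_rel_cong (chiE x) rN.
  split=> [/xr.2/cong_sym/cong_K|Kx]; first exact.
  by apply/xr.1; exact: K_cong.
Qed.

End Character.

(** By induction [x ^+ 2] is a power of [g ^+ 2] modulo [H], so [x / g ^+ j] has square in [H] and
    lies in [H] or [K]; in the latter case the factor [g ^+ (2 ^ n.+1)], itself in [K], corrects
    it. *)
Lemma cyclic_cover n g x : K (g ^+ (2 ^ n)) -> H (x ^+ (2 ^ n.+1)) ->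
  exists j, cong x (g ^+ j).
Proof.
elim: n g x => [|n IH] g x.
  rewrite expn0 expn1 expg1 => Kg /H2 [Hx|Kx].
    by exists 0%N; rewrite expg0; apply/cong1.
  by exists 1%N; rewrite expg1; exact: K_cong.
move=> Kg Hx; have [||j xj] := IH (g ^+ 2) (x ^+ 2); rewrite -?expgnA -?expnS //.
have : H ((x / (g ^+ j)) ^+ 2) by rewrite expgnFl // -expgnA mulnC expgnA.
move=> /H2 [xj'|Kxj]; first by exists j.
exists (2 ^ n.+1 + j)%N; rewrite expgnDr.
by have := K_cong Kxj Kg; rewrite /cong invgM mulgA.
Qed.

Lemma quasicyclic : exists k : exponents, exists chi : X -> C2 R (val k),
  [/\ forall x y, chi (x * y) = chi x * chi y, forall c, exists x, chi x = c,
     forall x, chi x = 1 <-> H x & forall x, chi x = C2N1 R k <-> K x].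
Proof.
have [z Kz] := Kne.
have topK x n : H (x ^+ (2 ^ n)) -> ~ H x ->
    exists2 m, (m < n)%N & K (x ^+ (2 ^ m)).
  elim: n => [|n IH]; first by rewrite expn0 expg1.
  rewrite expnSr expgnA => /H2 [Hx /(IH Hx) [m mn Km]|Kx _]; last by exists n.
  by exists m => //; rewrite ltnS ltnW.
(* With bounded exponent, an element of largest order generates [X/H]. Otherwise [X/H] is divisible
   by 2, and iterated square roots of an element of [K] form the required sequence. *)
have [[N0 bN0]|unb] := pselect (exists N, forall x, H (x ^+ (2 ^ N))).
  have exN : exists N, `[< forall x, H (x ^+ (2 ^ N)) >] by exists N0; apply/asboolP.
  case: (ex_minnP exN) => -[|N] /asboolP bN minN.
    by have := bN z; rewrite expn0 expg1 => /HK0.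
  have [g ng] : exists g, ~ H (g ^+ (2 ^ N)).
    apply/existsNP => bN'; have /minN : `[< forall x, H (x ^+ (2 ^ N)) >] by apply/asboolP.
    by rewrite ltnn.
  have Kg : K (g ^+ (2 ^ N)).
    by have := bN g; rewrite expnSr expgnA => /H2 [].
  exists (exist _ (Fin N.+1) (ltn0Sn N)).
  apply: (char_of_seq (g := fun n => g ^+ (2 ^ (N.+1 - n)))) => /= [||n nN|x].
  - exact: bN.
  - by rewrite subn1.
  - by rewrite -expgnA -expnSr subSS -subSn //; exact: cong_refl.
  - have [j xj] := cyclic_cover Kg (bN x); exists N.+1, j; split=> //.
    by rewrite subnn expn0 expg1.
have sqrt y : exists w, cong (w ^+ 2) y.
  have [n Hy] := H2n y.
  have [x nx] : exists x, ~ H (x ^+ (2 ^ n)).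
    by apply/existsNP => bn; apply: unb; exists n.
  have [m0 Hx] := H2n x; have [|m] := topK (x ^+ (2 ^ n)) m0 _ nx.
    by rewrite expgnAC; exact: HX.
  rewrite -expgnA -expnD => _ Kx.
  have [|j yj] := cyclic_cover Kx (x := y).
    by rewrite -addnS expnD expgnA; exact: HX.
  exists (x ^+ j./2); have [oj|ej] := boolP (odd j); last first.
    by rewrite -expgnA muln2 even_halfK //; exact: cong_sym.
  (* For odd [j], an odd power of an element of [K] would be congruent to a power of [y] lying in
     [H]. *)
  exfalso; have := KX oj Kx; rewrite expgnAC expnD expgnA; apply: HK0.
  by apply: HX; apply: cong_H Hy; exact: congX.
have [w wE] := choice sqrt.
exists (exist _ Infty isT).
pose g n := if n is n.+1 then iter n w z else 1.
have gS n : cong (g n.+1 ^+ 2) (g n).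
  by case: n => [|n]; [apply/cong1; exact: KK | exact: wE].
have gK n : K (g n.+1 ^+ (2 ^ n)).
  elim: n => [|n IH]; first by rewrite expn0 expg1.
  by rewrite expnS expgnA; apply: cong_K IH; apply/congX/cong_sym.
apply: (char_of_seq (g := g)) => //= [n _|x]; first exact: gS.
have [n Hx] := H2n x.
have [|j xj] := cyclic_cover (gK n) (x := x).
  by rewrite expnSr expgnA; exact: HX.
by exists n.+1, j.
Qed.

End QuasiCyclic.

(** * Maximal 2-cogroups *)

Section Cogroups.
Variables (R : realType) (X : groupType).
Hypothesis abelianX : forall x y : X, commute x y.
Implicit Types (x y z : X) (K : set X).

(** Double products leave [K] and triple products stay: [K] is an element of order 2 modulo the
    subgroup [K * K]. This form passes to unions of chains. *)
Definition cogroup K :=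
  [/\ K !=set0, forall x, K x -> K x^-1,
      forall x y z, K x -> K y -> K z -> K (x * y * z) &
      forall x y, K x -> K y -> ~ K (x * y)].

Let mulgAC x y z : x * y * z = x * z * y.
Proof. by rewrite -!mulgA (abelianX y). Qed.

Let mulgACA x y z t : x * y * (z * t) = x * z * (y * t).
Proof. by rewrite mulgA (mulgAC x y) -mulgA. Qed.

Lemma two_cogroupP (K : subsets X) : two_cogroup K <-> cogroup K.
Proof.
split=> [[K0 Kx]|[K0 KV KM Kd]].
  have KV x : K x -> K x^-1.
    move=> /[dup] Kx' /Kx [_ [/set_mem [y Ky xy] _] _].
    by rewrite (mulg1_eq xy).
  split=> // [x y z Kx' Ky Kz|x y Kx' Ky Kxy].
    have [_ [_ div] _] := Kx _ (KV _ Kx').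
    have /set_mem [t Kt] : x^-1 * y / (x^-1 * z^-1) \in ltranslate x^-1 K.
      by apply: div; apply/mem_set; [exists y|exists z^-1 => //; exact: KV].
    rewrite -mulgA => /mulgI tE; suff -> : x * y * z = t by [].
    by rewrite tE invgM !invgK mulgA [RHS]abelianX mulgA.
  have [_ _ d] := Kx _ Kx'; suff : set0 (x * y) by [].
  by rewrite -d; split=> //; exists y.
split=> // x Kx; split.
- by apply/seteqP; split=> _ [y Ky <-]; exists y => //; exact: abelianX.
- split; first by apply/mem_set; exists x^-1; [exact: KV|exact: mulgV].
  move=> _ _ /set_mem [y Ky <-] /set_mem [z Kz <-]; apply/mem_set.
  exists (x^-1 * y * z^-1); first by apply: KM => //; exact: KV.
  by rewrite invgM !mulgA mulgV mul1g -(mulgA x) (abelianX x) mulgK.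
- apply/seteqP; split=> // _ [[y Ky <-] Kxy]; exact: Kd Kx Ky Kxy.
Qed.

Lemma cogroup_maximal K : cogroup K ->
  exists K' : subsets X, maximal_two_cogroup K' /\ K `<=` K'.
Proof.
move=> cK; have [[z Kz] KV KM Kd] := cK.
pose P A := [/\ forall x, A x -> A x^-1,
  forall x y z, A x -> A y -> A z -> A (x * y * z),
  forall x y, A x -> A y -> ~ A (x * y) & A !=set0 -> K `<=` A].
have PK : P K by split=> // _ t.
have [F FP tF|A [[AV AM Ad AK] maxA]] := @Zorn_bigcup X P.
  have F2 A B : F A -> F B -> exists C, [/\ F C, A `<=` C & B `<=` C].
    by move=> FA FB; have [AB|BA] := tF _ _ FA FB; [exists B|exists A]; split=> // t.
  split=> [x [A FA Ax]|x y t [A FA Ax] [B FB By] [C FC Ct]|x y [A FA Ax] [B FB By]|].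
  - by exists A => //; have [AV _ _ _] := FP _ FA; exact: AV.
  - have [D [FD AD BD]] := F2 _ _ FA FB; have [E [FE DE CE]] := F2 _ _ FD FC.
    have [_ EM _ _] := FP _ FE; exists E => //.
    by apply: EM; [apply/DE/AD|apply/DE/BD|exact: CE].
  - move=> [C FC Ct].
    have [D [FD AD BD]] := F2 _ _ FA FB; have [E [FE DE CE]] := F2 _ _ FD FC.
    have [_ _ Ed _] := FP _ FE; apply: Ed (CE _ Ct).
      exact/DE/AD.
    exact/DE/BD.
  - move=> [x [A FA Ax]] t Kt; exists A => //.
    by have [_ _ _ AK] := FP _ FA; apply: AK Kt; exists x.
have A0 : A !=set0.
  apply: contrapT => A0; apply: (maxA K) => //; split=> [x Ax|KA].
    by exfalso; apply: A0; exists x.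
  by apply: A0; exists z; exact: KA.
exists A; split; last exact: AK.
split=> [|K' /two_cogroupP [K'0 K'V K'M K'd] AK']; first by apply/two_cogroupP.
apply: contrapT => neq; apply: (maxA K').
  split=> // K'A; apply: neq; exact/seteqP.
by split=> // _; apply: classical_sets.subset_trans AK'; exact: AK.
Qed.

Lemma conjugacy_class_abelian (K : subsets X) : conjugacy_class K = [set K].
Proof.
have cK x : conjugate x K = K.
  apply/seteqP; split=> [_ [y Ky <-]|y Ky]; first by rewrite mulgAC mulgV mul1g.
  by exists y => //; rewrite mulgAC mulgV mul1g.
by apply/seteqP; split=> [_ [x _ <-]|_ ->] /=; [|exists 1].
Qed.

Section Kernel.
Variable K : subsets X.
Hypothesis cK : cogroup K.
Let H : set X := K * K.

Lemma cogroup_kernel1 : H 1.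
Proof.
have [[z Kz] KV _ _] := cK.
by exists z => //; exists z^-1; [exact: KV|exact: mulgV].
Qed.

Lemma cogroup_kernelF x y : H x -> H y -> H (x / y).
Proof.
have [_ KV KM _] := cK; move=> [a Ka [b Kb <-]] [c Kc [d Kd <-]].
exists (a * b * d^-1); first by apply: KM => //; exact: KV.
by exists c^-1; [exact: KV|rewrite invgM !mulgA].
Qed.

Lemma cogroup_kernelM x y : H x -> K y -> K (x * y).
Proof. by have [_ _ KM _] := cK; move=> [a Ka [b Kb <-]] Ky; exact: KM. Qed.

Lemma cogroup_kernelMl x y : K x -> K y -> H (x * y).
Proof. by move=> Kx Ky; exists x => //; exists y. Qed.

Lemma cogroup_kernel_disjoint x : H x -> ~ K x.
Proof. by have [_ _ _ Kd] := cK; move=> [a Ka [b Kb <-]]; exact: Kd. Qed.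

Lemma cogroup_kernelP k x : K k -> H x <-> K (x * k).
Proof.
have [_ KV _ _] := cK; move=> Kk; split=> [Hx|Kxk]; first exact: cogroup_kernelM.
by exists (x * k) => //; exists k^-1; [exact: KV|rewrite mulgK].
Qed.

Lemma ltranslate_kernelP x y : ltranslate x H = ltranslate y H <-> H (x / y).
Proof.
have HF := cogroup_kernelF; have H1 := cogroup_kernel1.
have HV t : H t -> H t^-1 by rewrite -(mul1g t^-1); exact: HF.
have HM s t : H s -> H t -> H (s * t) by move=> Hs /HV /(HF _ _ Hs); rewrite invgK.
split=> [xy|Hxy].
  have [t Ht ytx] : ltranslate y H x by rewrite -xy; exists 1; rewrite ?mulg1.
  by rewrite -ytx abelianX mulKg.
suff sub a b : H (a / b) -> ltranslate a H `<=` ltranslate b H.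
  by apply/seteqP; split; apply: sub; rewrite // -invgF; exact: HV.
move=> Hab _ [t Ht <-]; exists (a / b * t); first exact: HM.
by rewrite mulgA (abelianX b) mulgVK.
Qed.

Lemma ltranslate_kernelM x y :
  (ltranslate x H : subsets X) * (ltranslate y H : subsets X) = ltranslate (x * y) H.
Proof.
have HF := cogroup_kernelF; have H1 := cogroup_kernel1.
have HV t : H t -> H t^-1 by rewrite -(mul1g t^-1); exact: HF.
have HM s t : H s -> H t -> H (s * t) by move=> Hs /HV /(HF _ _ Hs); rewrite invgK.
apply/seteqP; split=> [_ [_ [s Hs <-] [_ [t Ht <-] <-]]|_ [t Ht <-]].
  exists (s * t); first exact: HM.
  by rewrite !mulgA (mulgAC x s).
exists x; first by exists 1; rewrite ?mulg1.
by exists (y * t); [exists t|rewrite mulgA].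
Qed.

End Kernel.

(** If no power of [x] is in [K], then [K] times the powers of [x] is again a 2-cogroup, so equals
    [K] by maximality, which forces [x] into [K * K]. *)
Lemma maximal_cogroup_power (K : subsets X) : maximal_two_cogroup K ->
  forall x, ~ (K * K)%g x -> exists n, K (x ^+ n).
Proof.
move=> [/two_cogroupP cK maxK] x nHx; apply: contrapT => nKx.
have [[z Kz] KV KM Kd] := cK.
(* An integer exponent of [x] is written as a difference of naturals [m], [n]. *)
pose K' : subsets X := [set t | exists k m n, K k /\ t = k * x ^+ m / x ^+ n].
have xD k m n k' m' n' :
    (k * x ^+ m / x ^+ n) * (k' * x ^+ m' / x ^+ n') =
    k * k' * x ^+ (m + m') / x ^+ (n + n').
  by rewrite !expgnDr mulgACA invgM (abelianX (_ ^- n')) (mulgACA k).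
have KK' : K `<=` K'.
  by move=> k Kk; exists k, 0%N, 0%N; split=> //; rewrite expg0 mulg1 divg1.
have cK' : two_cogroup K'.
  apply/two_cogroupP; split.
  - by exists z; exact: KK'.
  - move=> _ [k [m [n [Kk ->]]]]; exists k^-1, n, m; split; first exact: KV.
    by rewrite !invgM invgK mulgA [LHS]abelianX mulgA.
  - move=> _ _ _ [k1 [m1 [n1 [K1 ->]]]] [k2 [m2 [n2 [K2 ->]]]] [k3 [m3 [n3 [K3 ->]]]].
    by rewrite !xD; eexists _, _, _; split; last reflexivity; exact: KM.
  - move=> _ _ [k1 [m1 [n1 [K1 ->]]]] [k2 [m2 [n2 [K2 ->]]]] [k [m [n [Kk]]]].
    rewrite xD => e.
    have {}e : k1 * k2 * k^-1 * x ^+ (m1 + m2 + n) = x ^+ (m + (n1 + n2)).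
      move: (m1 + m2)%N (n1 + n2)%N e => p q e.
      have {}e : k1 * k2 * x ^+ p * x ^+ n = k * x ^+ m * x ^+ q.
        by rewrite -[k1 * k2 * _](mulgVK (x ^+ q)) e (mulgAC _ _ (x ^+ n)) mulgVK.
      rewrite !expgnDr mulgA (mulgAC (k1 * k2)) (mulgAC _ k^-1) e -2!mulgA.
      by rewrite abelianX mulgA mulgVK.
    have {}Kk : K (k1 * k2 * k^-1) by apply: KM => //; exact: KV.
    move: (_ + n)%N (m + _)%N e => p q e; apply: nKx.
    have [pq|/ltnW qp] := leqP p q.
      by exists (q - p)%N; rewrite expgnFr // -e mulgK.
    exists (p - q)%N; rewrite expgnFr // -e invgM mulgA mulgV mul1g.
    exact: KV.
have Kxz : K (x * z).
  have <- : K' = K by exact: maxK.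
  by exists z, 1%N, 0%N; split=> //; rewrite expg0 divg1 expg1 abelianX.
by apply: nHx; apply/(cogroup_kernelP cK x Kz).
Qed.

(** Let [x ^+ i] be in [K]. If [i] is [2 ^ m] times an odd number, then [x ^+ (2 ^ m.+1)] is in
    [K * K]; if [x ^+ 2] is in [K * K], then [i] is odd and [x] itself is in [K]. These are the
    hypotheses of [quasicyclic]. *)
Lemma maximal_cogroup_char (K : subsets X) : maximal_two_cogroup K ->
  exists k : exponents, exists chi : X -> C2 R (val k),
  [/\ forall x y, chi (x * y) = chi x * chi y, forall c, exists x, chi x = c,
     forall x, chi x = 1 <-> (K * K)%g x & forall x, chi x = C2N1 R k <-> K x].
Proof.
move=> mK; have pK := maximal_cogroup_power mK.
have [/two_cogroupP cK _] := mK; have [K0 KV KM Kd] := cK.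
have H1 := cogroup_kernel1 cK; have HF := cogroup_kernelF cK.
have HK := cogroup_kernelM cK; have KK := @cogroup_kernelMl K.
have HK0 := cogroup_kernel_disjoint cK.
have oddK := KX abelianX H1 HF HK KK; have HXn := HX H1 HF.
apply: quasicyclic => // x.
  have [Hx|/pK [i Ki]] := pselect ((K * K)%g x).
    by exists 0%N; rewrite expn0 expg1.
  have i0 : (0 < i)%N.
    by case: i Ki => //; rewrite expg0 => /HK0.
  have [q] := pfactor_coprime (isT : prime 2) i0.
  rewrite coprime2n => oq; move: (logn 2 i) => m iE; exists m.+1.
  apply: contrapT => /pK [l Kl]; apply: (HK0 _ _ (oddK _ _ oq Kl)).
  rewrite expgnAC; apply: HXn; rewrite -expgnA mulnC expnS mulnCA -iE mulnC expgnA expg2.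
  exact: KK.
have [Hx|/pK [i Ki]] := pselect ((K * K)%g x); first by left.
move=> Hx2; right; have [oi|ei] := boolP (odd i); last first.
  by move: Ki; rewrite -(even_halfK ei) -mul2n expgnA => /(HK0 _ (HXn _ _ Hx2)).
move: Ki; rewrite -(odd_double_half i) oi add1n expgS -mul2n expgnA => Ki.
rewrite -(mulgK ((x ^+ 2) ^+ i./2) x) abelianX; apply: HK => //.
by rewrite -(mul1g (_^-1)); apply: HF => //; exact: HXn.
Qed.

End Cogroups.

(** The powers of 2 that kill the group determine [k]; [false] records that none kills the infinite
    one. *)
Lemma C2_exponent (R : realType) (k : exponents) m :
  (forall c : C2 R (val k), c ^+ (2 ^ m) = 1) <->
  (if val k is Fin n then n <= m else false)%N = true.
Proof.
have zE n : (if val k is Fin N then n <= N else true)%N ->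
    exists c : C2 R (val k), val c = zeta R n.
  by move=> nk; apply: C2_ofP; exact: zeta_dyadic.
have zX n (c : C2 R (val k)) : val c = zeta R n -> c ^+ (2 ^ m) = 1 -> (n <= m)%N.
  move=> cE /(congr1 val); rewrite C2X cE => /eqP.
  by rewrite -(prim_order_dvd (zeta_prim R n)) dvdn_Pexp2l.
case: k zE zX => -[n|] k0 /= zE zX; split=> //.
- by move=> c1; have [c cE] := zE n (leqnn n); exact: zX cE (c1 c).
- move=> nm c; apply: val_inj; have := set_mem (valP c) : (val c ^+ (2 ^ n) = 1)%R.
  move=> cn; rewrite (@C2X R (exist _ (Fin n) k0)) -(subnKC nm) expnD exprM cn expr1n //.
- by move=> c1; have [c cE] := zE m.+1 isT; have := zX _ _ cE (c1 c); rewrite ltnn.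
Qed.

(** * Characters attached to the classes counted by q(X,C) *)

Section Index.
Variables (R : realType) (X : groupType).
Hypothesis abelianX : forall x y : X, commute x y.

(* The disjoint union over [k] of the index sets of the products in the theorem;
   it enumerates the maximal 2-cogroups of [X]. *)
Definition cogroup_index : Type := {k : exponents & qset X (C2 R (val k))}.

Local Notation index := cogroup_index.
Implicit Types j : index.

(** An index only carries the existence of an isomorphism; a chosen one, composed with the quotient
    map, is [chi j]. It sends [K] to -1, the only element of order 2. Conversely
    [maximal_cogroup_char] provides an index for every maximal 2-cogroup. *)
Lemma index_characters : exists chi : forall j, X -> C2 R (val (tag j)),
  [/\ forall j x y, chi j (x * y) = chi j x * chi j y,
      forall j c, exists x, chi j x = c,
      forall j, maximal_two_cogroup ([set x | chi j x = C2N1 R (tag j)] : subsets X),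
      forall j j', [set x | chi j x = C2N1 R (tag j)] = [set x | chi j' x = C2N1 R (tag j')] ->
        j = j' &
      forall K : subsets X, maximal_two_cogroup K ->
        exists j, K = [set x | chi j x = C2N1 R (tag j)]].
Proof.
pose char_of (K : subsets X) (k : exponents) (chi : X -> C2 R (val k)) :=
  [/\ forall x y, chi (x * y) = chi x * chi y, forall c, exists x, chi x = c,
     forall x, chi x = 1 <-> (K * K)%g x & forall x, chi x = C2N1 R k <-> K x].
have ex j : exists chi : X -> C2 R (val (tag j)), exists K : subsets X,
    [/\ maximal_two_cogroup K, char_of K (tag j) chi & val (tagged j) = [set K]].
  case: j => k q; have [K [mK [f [fB fM]]] cE] := set_mem (valP q).
  have [/two_cogroupP -/(_ abelianX) cK _] := mK.
  have Kx x : characteristic_group K (ltranslate x (K * K : subsets X)).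
    exists x => //; rewrite /Stab /=; have : [set K] (conjugate x K).
      by rewrite -(conjugacy_class_abelian abelianX); exists x.
    by [].
  pose chi x := f (ltranslate x (K * K)%g).
  have [f1 f2 f3] := fB.
  have chiM x y : chi (x * y) = chi x * chi y.
    by rewrite /chi -fM // (ltranslate_kernelM abelianX cK).
  have chiE x y : chi x = chi y <-> (K * K)%g (x / y).
    rewrite -(ltranslate_kernelP abelianX cK); split=> [xy|xy].
      by apply: f2 xy; apply/mem_set.
    by congr f.
  have chi1 : chi 1 = 1 by apply: (@mulgI _ (chi 1)); rewrite -chiM !mulg1.
  have chi1P x : chi x = 1 <-> (K * K)%g x by rewrite -chi1 chiE divg1.
  have KN x : K x -> chi x = C2N1 R k.
    move=> xK; have [|cx1|//] := @C2_sq1 R k (chi x).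
      by rewrite -chiM; apply/chi1P; exact: cogroup_kernelMl.
    by exfalso; apply: cogroup_kernel_disjoint cK _ _ xK; apply/chi1P.
  exists chi, K; split=> //; last by rewrite -cE /= conjugacy_class_abelian.
  split=> // [d|x]; first by have [_ [x _ <-] <-] := f3 d I; exists x.
  split=> [xN|]; last exact: KN.
  have [[z Kz] _ _ _] := cK; rewrite -(mulgVK z x).
  by apply: (cogroup_kernelM cK) => //; apply/chiE; rewrite xN KN.
pose chi j := projT1 (cid (ex j)).
have chiP j : exists K : subsets X,
    [/\ maximal_two_cogroup K, char_of K (tag j) (chi j) & val (tagged j) = [set K]].
  exact: projT2 (cid (ex j)).
have KE j (K : subsets X) : char_of K (tag j) (chi j) ->
    K = [set x | chi j x = C2N1 R (tag j)].
  by move=> [_ _ _ KN]; apply/seteqP; split=> x; have [] := KN x.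
exists chi; split=> [j x y|j c|j|j j' jj'|K mK].
- by have [K [_ [-> _ _ _] _]] := chiP j.
- by have [K [_ [_ + _ _] _]] := chiP j.
- by have [K [mK /KE <- _]] := chiP j.
- have [K [mK cK qK]] := chiP j; have [K' [mK' cK' qK']] := chiP j'.
  have KK' : K' = K by rewrite (KE _ _ cK) (KE _ _ cK') jj'.
  (* Which powers of 2 kill the group is visible from [K * K], so equal cogroups have the same
     [k]. *)
  have expE m : (forall c : C2 R (val (tag j)), c ^+ (2 ^ m) = 1) <->
      (forall c : C2 R (val (tag j')), c ^+ (2 ^ m) = 1).
    have chiX i x n : chi i (x ^+ n) = chi i x ^+ n.
      have [K'' [_ [chiM _ chi1 _] _]] := chiP i.
      elim: n => [|n IH]; last by rewrite !expgS chiM IH.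
      by apply: (@mulgI _ (chi i 1)); rewrite -chiM !mulg1.
    have expK i (L : subsets X) : char_of L (tag i) (chi i) ->
        (forall c : C2 R (val (tag i)), c ^+ (2 ^ m) = 1) <->
        (forall x, (L * L)%g (x ^+ (2 ^ m))).
      move=> [_ chiS chi1 _]; split=> [c1 x|x1 c]; first by apply/chi1; rewrite chiX.
      by have [x <-] := chiS c; rewrite -chiX; apply/chi1.
    by rewrite (expK _ _ cK) (expK _ _ cK') KK'.
  have tagE : tag j = tag j'.
    apply: val_inj; have := expE; move: (tag j) (tag j') => k k' {}expE.
    have {}expE m : (if val k is Fin n then n <= m else false)%N =
        (if val k' is Fin n then n <= m else false)%N.
      apply/idP/idP => h.
        by apply: (C2_exponent R k' m).1; apply/expE; exact: (C2_exponent R k m).2.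
      by apply: (C2_exponent R k m).1; apply/expE; exact: (C2_exponent R k' m).2.
    case: (val k) (val k') expE => [n|] [n'|] // expE.
    - by congr Fin; apply/eqP; rewrite eqn_leq expE leqnn -expE leqnn.
    - by have := expE n; rewrite leqnn.
    - by have := expE n'; rewrite leqnn.
  move: qK qK'; rewrite KK'; case: j j' tagE {jj' cK cK' expE} => k q [k' q'] /= kk'.
  by case: _ / kk' q' => q' qE q'E; congr existT; apply: val_inj; exact: etrans qE (esym q'E).
- have [k [chi0 [chiM chiS chi1 chiN]]] := maximal_cogroup_char R abelianX mK.
  have [/two_cogroupP -/(_ abelianX) cK _] := mK.
  have [[z Kz] _ _ _] := cK.
  have iso : isomorphic (characteristic_group K) [set: C2 R (val k)].
    pose f (A : subsets X) := chi0 (xget 1 A).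
    have fE x : f (ltranslate x (K * K)%g) = chi0 x.
      have [|t /chi1 Ht tE] := @xgetPex _ 1 (ltranslate x (K * K)%g).
        by exists (x * 1), 1 => //; exact: cogroup_kernel1.
      by rewrite /f -tE chiM Ht mulg1.
    exists f; split; first split=> //.
    - move=> _ _ /set_mem [x _ <-] /set_mem [y _ <-]; rewrite !fE => xy.
      apply/(ltranslate_kernelP abelianX cK)/chi1.
      by apply: (@mulIg _ (chi0 y)); rewrite -chiM mulgVK mul1g.
    - move=> c _; have [x xc] := chiS c; exists (ltranslate x (K * K)%g); last by rewrite fE.
      exists x => //; have : [set K] (conjugate x K).
        by rewrite -(conjugacy_class_abelian abelianX); exists x.
      by [].
    - move=> _ _ [x _ <-] [y _ <-].
      by rewrite (ltranslate_kernelM abelianX cK) !fE.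
  have qP : conjugacy_class K \in qset X (C2 R (val k)) by apply/mem_set; exists K.
  pose j : index := existT (fun k : exponents => qset X (C2 R (val k)) : Type) k
    (exist (fun c => c \in qset X (C2 R (val k))) _ qP).
  exists j; have [K' [mK' /KE <- /=]] := chiP j.
  rewrite conjugacy_class_abelian // => /(congr1 (@^~ K)) /= e.
  by rewrite -e.
Qed.

End Index.

(** * Coordinates on maximal twins *)

Section Coordinates.
Variables (R : realType) (X : groupType).
Hypothesis abelianX : forall x y : X, commute x y.
Local Notation index := (cogroup_index R X).
Implicit Types (j : index) (A B : set X) (x y : X).

Lemma natural_twin f A x : natural f -> shift x A = ~` A -> shift x (f A) = ~` f A.
Proof. by move=> [fS fC _] xA; rewrite -fS xA fC. Qed.

Lemma shift_neqC A x : shift x A = ~` A -> shift x A <> A.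
Proof.
move=> -> e; have [a|na] := pselect (A 1); last by apply: (na); rewrite -e.
by have : (~` A) 1 by rewrite e.
Qed.

Lemma twin_cogroup A : twin A -> cogroup [set x | shift x A = ~` A].
Proof.
move=> tA; split=> //= [x xA|x y z xA yA zA|x y xA yA].
- by apply: (@shift_inj _ x); rewrite shiftM mulVg shift1 shiftC xA setCK.
- by rewrite -!shiftM xA !shiftC yA !shiftC zA setCK.
- by rewrite -shiftM xA shiftC yA setCK => AA; apply: (shift_neqC xA); rewrite xA; exact: esym.
Qed.

Variable chi : forall j, X -> C2 R (val (tag j)).
Hypothesis chiM : forall j x y, chi j (x * y) = chi j x * chi j y.
Hypothesis chiS : forall j c, exists x, chi j x = c.
Hypothesis chiK : forall j,
  maximal_two_cogroup ([set x | chi j x = C2N1 R (tag j)] : subsets X).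
Hypothesis chi_inj : forall j j',
  [set x | chi j x = C2N1 R (tag j)] = [set x | chi j' x = C2N1 R (tag j')] -> j = j'.

(* The sets whose stabilizer up to complement contains the maximal 2-cogroup
   of index [j]. *)
Definition block j A := forall x, chi j x = C2N1 R (tag j) -> shift x A = ~` A.

(** [z] labels an orbit of the block and [c] the position in it. This is a predicate on [pt] because
    each minimal left ideal will need its own coordinates. *)
Definition coordinates (pt : forall j, C2 R (val (tag j)) -> Zcube (val (tag j)) -> set X) :=
  [/\ forall j c z x, shift x (pt j c z) = pt j (chi j x * c) z,
      forall j c z j' c' z', pt j c z = pt j' c' z' -> j = j',
      forall j c z c' z', pt j c z = pt j c' z' -> c = c' /\ z = z' &
      forall j A, block j A <-> exists c z, A = pt j c z].

Lemma block_twin j A : block j A -> twin A.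
Proof. by have [x xN] := chiS (C2N1 R (tag j)); move=> /(_ x xN) xA; exists x. Qed.

(** The translations complementing [A] form a 2-cogroup containing two maximal ones, hence equal to
    both. *)
Lemma block_disjoint j j' A : block j A -> block j' A -> j = j'.
Proof.
move=> jA j'A; have cA := twin_cogroup (block_twin jA).
by apply: chi_inj; rewrite -(proj2 (chiK j) _ ((two_cogroupP abelianX _).2 cA) jA)
  -(proj2 (chiK j') _ ((two_cogroupP abelianX _).2 cA) j'A).
Qed.

(** Both [n] and [y / x * n] have character -1 and complement [A], so [y / x] fixes [A]. *)
Lemma block_kernel j A x y : block j A -> chi j x = chi j y -> A x -> A y.
Proof.
move=> jA xy; have [n nN] := chiS (C2N1 R (tag j)).
have nA := jA n nN; have := jA (y / x * n).
rewrite !chiM nN -xy -chiM mulgV.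
have -> : chi j 1 = 1 by apply: (@mulgI _ (chi j 1)); rewrite -chiM !mulg1.
rewrite mul1g -nA => /(_ erefl) /(congr1 (@^~ (n^-1 * x))).
by rewrite /shift /= mulVKg -mulgA mulVKg mulgVK => ->.
Qed.

(** By [block_kernel] a set of the block is the preimage under [chi j] of a set in the dyadic group,
    and the block condition says that its indicator is odd; [odd_coord] applies. *)
Lemma coordinates_exist : exists pt, coordinates pt.
Proof.
pose p j := projT1 (cid (odd_coord R (tag j))).
have pP j : [/\ forall c z, odd_fun (p j c z),
      forall F, odd_fun F -> exists c z, F = p j c z,
      forall c z c' z', p j c z = p j c' z' -> c = c' /\ z = z' &
      forall c z d, p j c z d = p j 1 z (c * d)].
  exact: projT2 (cid (odd_coord R (tag j))).
pose pt j c z : set X := [set x | p j c z (chi j x)].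
have ptS j c z x : shift x (pt j c z) = pt j (chi j x * c) z.
  apply/funext => y; rewrite /shift /pt /= chiM; have [_ _ _ pE] := pP j.
  by rewrite pE [in RHS]pE mulgA (C2_comm c).
have ptB j c z : block j (pt j c z).
  move=> x xN; apply/funext => y; rewrite /shift /pt /= chiM xN.
  by have [-> _ _ _] := pP j; apply/propext; split=> /negP.
exists pt; split=> // [j c z j' c' z' e|j c z c' z' e|j A].
- by apply: (@block_disjoint _ _ (pt j c z)) => //; rewrite e.
- have [_ _ pI _] := pP j; apply: pI; apply/funext => d.
  by have [x <-] := chiS d; apply/idP/idP => h; have := congr1 (@^~ x) e;
    rewrite /pt /= => eq; [rewrite -eq|rewrite eq].
split=> [jA|[c [z ->]] //].
have [s sE] := choice (chiS (j := j)).
pose F c := `[< A (s c) >].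
have AE x : A x <-> F (chi j x).
  by split=> [Ax|/asboolP]; [apply/asboolP; apply: block_kernel jA _ Ax|
    apply: block_kernel jA _]; rewrite sE.
have oF : odd_fun F.
  move=> c; have [n nN] := chiS (C2N1 R (tag j)); have [x <-] := chiS c.
  rewrite -nN -chiM; apply/idP/negP => [/AE nx /AE Ax|nAx].
    by have : (~` A) x by rewrite -(jA n nN).
  apply/AE; suff : shift n A x by [].
  by rewrite (jA n nN) => /AE.
have [_ pS _ _] := pP j; have [c [z FE]] := pS F oF.
exists c, z; apply/seteqP; split=> x; rewrite /pt /= -FE; first by move/AE.
by move=> Fx; apply/AE.
Qed.

End Coordinates.

(** * Retractions onto maximal twins *)

Section Retraction.
Variables (R : realType) (X : groupType).
Hypothesis abelianX : forall x y : X, commute x y.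
Local Notation index := (cogroup_index R X).
Implicit Types (j : index) (A B : set X) (x y : X).

Variable chi : forall j, X -> C2 R (val (tag j)).
Hypothesis chiM : forall j x y, chi j (x * y) = chi j x * chi j y.
Hypothesis chiS : forall j c, exists x, chi j x = c.
Hypothesis chiK : forall j,
  maximal_two_cogroup ([set x | chi j x = C2N1 R (tag j)] : subsets X).
Hypothesis chi_inj : forall j j',
  [set x | chi j x = C2N1 R (tag j)] = [set x | chi j' x = C2N1 R (tag j')] -> j = j'.
Hypothesis chi_surj : forall K : subsets X, maximal_two_cogroup K ->
  exists j, K = [set x | chi j x = C2N1 R (tag j)].

Definition maximal_twin A := exists j, block chi j A.

Definition retraction (e : set X -> set X) :=
  [/\ natural e, forall A, [\/ e A = set0, e A = setT | maximal_twin (e A)] &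
      forall A, maximal_twin A -> e A = A].

Lemma maximal_twin_twin A : maximal_twin A -> twin A.
Proof. by move=> [j]; exact: block_twin. Qed.

Lemma block_shift j x A : block chi j A -> block chi j (shift x A).
Proof. by move=> jA y yN; rewrite shiftAC // jA // shiftC. Qed.

Lemma twin_target A : twin A ->
  exists B, [/\ maximal_twin B, forall x, shift x A = ~` A -> shift x B = ~` B &
                maximal_twin A -> B = A].
Proof.
move=> tA; have [mA|nmA] := pselect (maximal_twin A); first by exists A.
have [K [/chi_surj [j ->] sub]] := cogroup_maximal abelianX (twin_cogroup tA).
have [pt [_ _ _ ptB]] := coordinates_exist abelianX chiM chiS chiK chi_inj.
(* Any member of the block would do; the position and the label are arbitrary. *)
have jB : block chi j (pt j 1 (fun=> true)) by apply/ptB; exists 1, (fun=> true).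
by exists (pt j 1 (fun=> true)); split=> [|x /sub xN|//]; [exists j|exact: jB].
Qed.

(** The target is chosen once per orbit, at the representative [o A], and carried back along the
    translation [g A] that leads there. *)
Lemma twin_retraction : exists f : set X -> set X, forall A, twin A ->
  [/\ forall x, f (shift x A) = shift x (f A), maximal_twin (f A),
      forall x, shift x A = ~` A -> shift x (f A) = ~` f A &
      maximal_twin A -> f A = A].
Proof.
have exr A : exists B, twin A ->
    [/\ maximal_twin B, forall x, shift x A = ~` A -> shift x B = ~` B &
        maximal_twin A -> B = A].
  have [/twin_target [B BP]|nA] := pselect (twin A); first by exists B.
  by exists A.
have [r rP] := choice exr.
pose o A := xget set0 [set B | exists x, B = shift x A].
have exg A : exists g, o A = shift g A.
  by apply: (@xgetPex _ set0 [set B | exists x, B = shift x A]); exists A, 1; rewrite shift1.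
have [g gE] := choice exg.
have oS x A : o (shift x A) = o A.
  congr xget; apply/seteqP; split=> _ [y ->]; first by exists (x * y); rewrite shiftM.
  by exists (x^-1 * y); rewrite shiftM mulVKg.
have twS x A : twin A -> twin (shift x A).
  by move=> [y yA]; exists y; rewrite shiftAC // yA.
exists (fun A => shift (g A)^-1 (r (o A))) => A tA.
have toA : twin (o A) by rewrite gE; exact: twS.
have [mr rN rid] := rP _ toA; split=> [x||x xA|mA].
- rewrite /= oS; set B := r (o A).
  (* The two ways of carrying [B] back differ by [w], which fixes [A]. As [n] and [w * n] complement
     [o A], they complement [B], so [w] fixes [B]. *)
  pose w := x * g (shift x A) * (g A)^-1.
  have wA : shift w A = A.
    rewrite /w -shiftM -[shift (x * _) A]shiftM -gE oS gE.
    by rewrite shiftM mulgV shift1.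
  have [n nA] := toA.
  have woA : shift w (o A) = o A by rewrite gE shiftAC // wA.
  have : shift (w * n) B = ~` B by apply: rN; rewrite -shiftM woA.
  rewrite -shiftM -(rN _ nA) => /shift_inj; rewrite -/B => wB.
  rewrite -{1}wB !shiftM; congr (shift _ B); rewrite /w.
  by rewrite abelianX (abelianX x) -mulgA mulKg abelianX.
- by have [j jr] := mr; exists j; exact: block_shift.
- by rewrite shiftAC // rN ?shiftC // gE shiftAC // xA shiftC.
- rewrite rid; first by rewrite gE shiftM mulgV shift1.
  by have [j jA] := mA; exists j; rewrite gE; exact: block_shift.
Qed.

Lemma retraction_exists : exists e, retraction e.
Proof.
have [L [lL iL uL twL]] := invariant_linked_max abelianX.
have [f fP] := twin_retraction.
have iLE x A : L (shift x A) <-> L A.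
  by split=> [/(iL x^-1)|/iL //]; rewrite shiftM mulgV shift1.
have LC A : L A -> ~ L (~` A).
  by move=> LA /(lL _ _ LA) [x []].
have LX A : L A \/ L (~` A) \/ [/\ ~ L A, ~ L (~` A) & twin A].
  have [LA|nLA] := pselect (L A); [by left|right].
  have [LCA|nLCA] := pselect (L (~` A)); [by left|right; split=> //].
  exact: twL.
pose e A := if `[< L A >] then setT else if `[< L (~` A) >] then set0 else f A.
have eT A : L A -> e A = setT by rewrite /e => LA; case: asboolP.
have e0 A : L (~` A) -> e A = set0.
  by rewrite /e => LA; case: asboolP => [/LC //|_]; case: asboolP.
have ef A : ~ L A -> ~ L (~` A) -> e A = f A.
  by rewrite /e => nL nL'; case: asboolP => // _; case: asboolP.
have emax A : maximal_twin A -> e A = A.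
  move=> mA; have [x xA] := maximal_twin_twin mA.
  have nL : ~ L A by move=> /[dup] /LC + /(iL x); rewrite xA.
  rewrite ef //; last by rewrite -xA iLE.
  by have [_ _ _ ->] := fP _ (ex_intro _ x xA).
exists e; split=> //.
- split=> [x A|A|A B AB].
  + have [LA|[LA|[nL nL' tA]]] := LX A.
    * by rewrite !eT ?iLE.
    * by rewrite !e0 // -shiftC iLE.
    * rewrite !ef //; first by have [-> _ _ _] := fP _ tA.
        by rewrite iLE.
      by rewrite -shiftC iLE.
  + have [LA|[LA|[nL nL' tA]]] := LX A.
    * by rewrite (eT A) // e0 ?setCK ?setCT.
    * by rewrite (e0 A) // eT // setC0.
    * rewrite !ef ?setCK //; have [x xA] := tA; have [fS _ fN _] := fP _ tA.
      by rewrite -xA fS fN.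
  (* Upward closure of [L] settles every case except an inclusion between two twins, which is an
     equality. *)
  + have [LA|[LA|[nL nL' tA]]] := LX A.
    * by rewrite (eT B) //; exact: uL AB.
    * by rewrite (e0 A).
    * have [LB|[LB|[nLB nLB' tB]]] := LX B; first by rewrite (eT B).
        by exfalso; apply: nL'; apply: uL LB _; exact: subsetC.
      by rewrite (twin_antichain abelianX tA tB AB).
- move=> A; have [LA|[LA|[nL nL' tA]]] := LX A.
  + by constructor 2; exact: eT.
  + by constructor 1; exact: e0.
  + by constructor 3; rewrite ef //; have [] := fP _ tA.
Qed.

(** Among the values of [e], the only inclusions are equalities and those involving the empty set or
    [X]. So any map of the points that commutes with positions is natural after [e]. *)
Lemma retraction_extend (pt : forall j, C2 R (val (tag j)) -> Zcube (val (tag j)) -> set X)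
    e (w : forall j, wreath (C2 R (val (tag j))) (Zcube (val (tag j)))) :
  coordinates chi pt -> retraction e ->
  exists u : superextension X, forall A,
    [/\ e A = set0 -> action u A = set0, e A = setT -> action u A = setT &
        forall j c z, e A = pt j c z -> action u A = pt j ((w j).1 z * c) ((w j).2 z)].
Proof.
move=> [ptS ptJ ptI ptB] [[eS eC eU] eV eid].
have ptT j c z : twin (pt j c z).
  by apply: (@block_twin _ _ chi chiS j); apply/ptB; exists c, z.
have t0 A : twin A -> A <> set0.
  by move=> [x xA] A0; have : shift x A 1; [rewrite xA A0|rewrite A0].
have tT A : twin A -> A <> setT.
  move=> [x xA] AT; have : (~` A) 1; last by rewrite AT; apply.
  by rewrite -xA AT.
have exF B : exists B', [/\ B = set0 -> B' = set0, B = setT -> B' = setT &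
    forall j c z, B = pt j c z -> B' = pt j ((w j).1 z * c) ((w j).2 z)].
  have [[j [c [z BE]]]|nB] := pselect (exists j c z, B = pt j c z).
    exists (pt j ((w j).1 z * c) ((w j).2 z)); split.
    - by move=> B0; case: (t0 _ (ptT j c z)); rewrite -BE.
    - by move=> BT; case: (tT _ (ptT j c z)); rewrite -BE.
    - move=> j' c' z'; rewrite BE => ee; have jj' := ptJ _ _ _ _ _ _ ee.
      by move: c' z' ee; case: _ / jj' => c' z' /ptI [-> ->].
  by exists B; split=> // j c z BE; case: nB; exists j, c, z.
have [F FP] := choice exF.
have F0 : F set0 = set0 by have [->] := FP set0.
have FT : F setT = setT by have [_ ->] := FP setT.
have Fpt j c z : F (pt j c z) = pt j ((w j).1 z * c) ((w j).2 z).
  by have [_ _ FE] := FP (pt j c z); exact: FE.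
have maxpt A : maximal_twin A -> exists j c z, A = pt j c z.
  by move=> [j /ptB [c [z ->]]]; exists j, c, z.
have [|u uE] := @action_surj X (fun A => F (e A)); last first.
  by exists u => A; rewrite uE; split=> [->|->|j c z ->].
split=> [x A|A|A B /eU].
- rewrite eS; case: (eV A) => [->|->|/maxpt [j [c [z ->]]]]; rewrite ?F0 ?FT //.
  by rewrite ptS !Fpt ptS !mulgA (C2_comm (chi j x)).
- rewrite eC; case: (eV A) => [->|->|/maxpt [j [c [z ->]]]].
  + by rewrite setC0 F0 FT setC0.
  + by rewrite setCT F0 FT setCT.
  + have [x xN] := chiS (C2N1 R (tag j)).
    have ptN c' z' : ~` pt j c' z' = pt j (C2N1 R (tag j) * c') z'.
      have jB : block chi j (pt j c' z') by apply/ptB; exists c', z'.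
      by rewrite -(jB x xN) ptS xN.
    by rewrite ptN !Fpt ptN !mulgA (C2_comm (C2N1 _ _)).
- case: (eV A) => [->|->|/maxpt [j [c [z ->]]]]; first by rewrite F0 => _ t.
    by rewrite subTset => ->.
  case: (eV B) => [->|->|/maxpt [j' [c' [z' ->]]]]; last first.
  + by move=> /(twin_antichain abelianX (ptT _ _ _) (ptT _ _ _)) ->.
  + by rewrite FT.
  + by rewrite subset0 => /(t0 _ (ptT _ _ _)).
Qed.

End Retraction.

(** * Left ideals *)

Section LeftIdeals.
Variable S : semigroupType.
Implicit Types (s m x y : S) (I J L M : set S).

Lemma principal_left_ideal_left x : left_ideal (principal_left_ideal x).
Proof.
split; first by exists (x * x), x.
by move=> s _ [t _ <-]; exists (s * t) => //; rewrite mulgA.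
Qed.

Lemma minimal_left_ideal_principal L x : minimal_left_ideal L -> L x ->
  L = principal_left_ideal x.
Proof.
move=> [[_ LM] minL] Lx; apply/esym/minL; first exact: principal_left_ideal_left.
by move=> _ [s _ <-]; exact: LM.
Qed.

(** For a left ideal [J] inside [L y], the elements of [L] that [y] carries into [J] form a left
    ideal, hence all of [L]. *)
Lemma minimal_left_ideal_mul L y : minimal_left_ideal L ->
  minimal_left_ideal [set x * y | x in L].
Proof.
move=> [[[l Ll] LM] minL]; split.
  split; first by exists (l * y), l.
  by move=> s _ [x Lx <-]; exists (s * x); [exact: LM|rewrite mulgA].
move=> J [[_j Jj] JM] JL; apply/seteqP; split=> // _ [x Lx <-].
have [l' Ll' ly] := JL _ Jj.
suff LE : L `&` [set x | J (x * y)] = L by move: Lx; rewrite -LE => -[].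
apply: minL; last by move=> ? [].
split; first by exists l'; split=> //=; rewrite ly.
by move=> s t [Lt Jt]; split; [exact: LM|rewrite /= -mulgA; exact: JM].
Qed.

(* The minimal ideal is contained in [S m S], so its elements lie in the
   minimal left ideals [S m y]. *)
Lemma minimal_ideal_left M m x : minimal_ideal M ->
  minimal_left_ideal (principal_left_ideal m) -> M x ->
  minimal_left_ideal (principal_left_ideal x).
Proof.
move=> [_ minM] minm Mx.
pose I : set S := [set t * b | t in principal_left_ideal m & b in [set: S]].
have idI : ideal I.
  split; first by exists (m * m * m), (m * m); [exists m|exists m].
  move=> s _ [_ [t _ <-] [b _ <-]]; split.
    by exists (s * t * m); [exists (s * t)|exists b; rewrite ?mulgA].
  by exists (t * m); [exists t|exists (b * s); rewrite ?mulgA].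
have [_ [t _ <-] [b _ xE]] := minM _ idI _ Mx.
have [left_mb minb] := minimal_left_ideal_mul b minm.
have -> : principal_left_ideal x = [set y * b | y in principal_left_ideal m].
  apply: minb; first exact: principal_left_ideal_left.
  move=> _ [s _ <-]; rewrite -xE; exists (s * (t * m)); last by rewrite !mulgA.
  by exists (s * t); rewrite ?mulgA.
exact: minimal_left_ideal_mul.
Qed.

End LeftIdeals.

(** * Wreath coordinates and the structure of minimal left ideals *)

Section Algebra.
Variables (R : realType) (X : groupType).
Hypothesis abelianX : forall x y : X, commute x y.
Local Notation index := (cogroup_index R X).
Implicit Types (j : index) (A B : set X) (x y : X) (u v : superextension X).

Variable chi : forall j, X -> C2 R (val (tag j)).
Hypothesis chiS : forall j c, exists x, chi j x = c.
Variable e : superextension X.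
Hypothesis eP : retraction chi (action e).

Let W (j : index) := wreath (C2 R (val (tag j))) (Zcube (val (tag j))).

Let extend (pt : forall j, C2 R (val (tag j)) -> Zcube (val (tag j)) -> set X)
  (w : forall j, W j) (ptP : coordinates chi pt) := retraction_extend abelianX chiS w ptP eP.

Section Coordinates.
Variable pt : forall j, C2 R (val (tag j)) -> Zcube (val (tag j)) -> set X.
Arguments pt : clear implicits.
Hypothesis ptP : coordinates chi pt.

(** A translation complementing a set complements its image, so blocks are preserved. Position 1 in
    each orbit suffices, equivariance giving the others. *)
Lemma wreath_of_exists : exists wr : superextension X -> forall j, W j,
  forall u j z, action u (pt j 1 z) = pt j ((wr u j).1 z) ((wr u j).2 z).
Proof.
have [ptS _ _ ptB] := ptP.
have ex u j z : exists cz : C2 R (val (tag j)) * Zcube (val (tag j)),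
    action u (pt j 1 z) = pt j cz.1 cz.2.
  have [|c [d ->]] := (ptB j (action u (pt j 1 z))).1; last by exists (c, d).
  by move=> x xN; apply: natural_twin (action_natural u) _; apply: (ptB j _).2 xN; exists 1, z.
pose cz u j z := projT1 (cid (ex u j z)).
exists (fun u j => (fun z => (cz u j z).1, fun z => (cz u j z).2)) => u j z.
exact: projT2 (cid (ex u j z)).
Qed.

Definition wreath_of := projT1 (cid wreath_of_exists).

Lemma action_pt u j c z :
  action u (pt j c z) = pt j ((wreath_of u j).1 z * c) ((wreath_of u j).2 z).
Proof.
have [ptS _ _ _] := ptP; have [x xc] := chiS c.
have -> : pt j c z = shift x (pt j 1 z) by rewrite ptS xc mulg1.
have [-> _ _] := action_natural u.
by rewrite (projT2 (cid wreath_of_exists) u j z) ptS xc C2_comm.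
Qed.

Lemma wreath_ofP u j h g :
  (forall z, action u (pt j 1 z) = pt j (h z) (g z)) -> wreath_of u j = (h, g).
Proof.
move=> uE; have [_ _ ptI _] := ptP.
have eq z : (wreath_of u j).1 z = h z /\ (wreath_of u j).2 z = g z.
  by apply: ptI; rewrite -uE action_pt mulg1.
by rewrite [LHS]surjective_pairing; congr pair; apply/funext => z; have [] := eq z.
Qed.

Lemma wreath_ofM u v j : wreath_of (u * v) j = wreath_of u j * wreath_of v j.
Proof. by apply: wreath_ofP => z; rewrite actionM !action_pt mulg1. Qed.

Lemma retraction_pt j (c : C2 R (val (tag j))) z : action e (pt j c z) = pt j c z.
Proof.
have [_ _ _ ptB] := ptP; have [_ _ -> //] := eP.
by exists j; apply: (ptB j _).2; exists c, z.
Qed.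

Lemma action0 u : action u set0 = set0. Proof. exact/natural0/action_natural. Qed.
Lemma actionT u : action u setT = setT. Proof. exact/naturalT/action_natural. Qed.

Lemma retraction_cases A : [\/ action e A = set0, action e A = setT |
  exists j (c : C2 R (val (tag j))) z, action e A = pt j c z].
Proof.
have [_ _ _ ptB] := ptP; have [_ /(_ A) [eA|eA|[j /ptB [c [z eA]]]] _] := eP.
- by constructor 1.
- by constructor 2.
- by constructor 3; exists j, c, z.
Qed.

Lemma principal_retractionP u : principal_left_ideal e u <->
  forall A, action u A = action u (action e A).
Proof.
split=> [[s _ <-] A|uE]; last first.
  by exists u => //; apply: action_inj; apply/funext => A; rewrite actionM -uE.
rewrite !actionM; congr (action s _).
case: (retraction_cases A) => [->|->|[j [c [z ->]]]].
- by rewrite action0.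
- by rewrite actionT.
- by rewrite retraction_pt.
Qed.

(** Right multiplication by [e] puts the extension of [w] into the ideal and keeps its coordinates,
    since [e] fixes all [pt j c z]. *)
Lemma extend_retraction (w : forall j, W j) :
  exists u, principal_left_ideal e u /\ forall j, wreath_of u j = w j.
Proof.
have [u0 u0E] := extend w ptP; exists (u0 * e); split; first by exists u0.
move=> j; rewrite [RHS]surjective_pairing; apply: wreath_ofP => z.
rewrite actionM retraction_pt; have [_ _ uE] := u0E (pt j 1 z).
by rewrite (uE j 1 z) ?mulg1 //; exact: retraction_pt.
Qed.

Lemma wreath_of_inj u v : principal_left_ideal e u -> principal_left_ideal e v ->
  (forall j, wreath_of u j = wreath_of v j) -> u = v.
Proof.
move=> /principal_retractionP uE /principal_retractionP vE uv.
apply: action_inj; apply/funext => A; rewrite uE vE.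
case: (retraction_cases A) => [->|->|[j [c [z ->]]]].
- by rewrite !action0.
- by rewrite !actionT.
- by rewrite !action_pt uv.
Qed.

Lemma principal_wreath : isomorphic (principal_left_ideal e)
  [set: qpower R X (fun k => wreath (C2 R k) (Zcube k))].
Proof.
pose F u : qpower R X (fun k => wreath (C2 R k) (Zcube k)) :=
  fun k q => wreath_of u (existT _ k q).
exists F; split; first split=> //.
- move=> u v /set_mem eu /set_mem ev uv; apply: wreath_of_inj => // -[k q].
  exact: (congr1 (fun f => f k q) uv).
- move=> f _; have [u [eu uf]] := extend_retraction (fun j => f (tag j) (tagged j)).
  exists u => //; apply: functional_extensionality_dep => k.
  by apply: functional_extensionality_dep => q; rewrite /F uf.
- move=> u v _ _; apply: functional_extensionality_dep => k.
  by apply: functional_extensionality_dep => q; rewrite /F wreath_ofM.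
Qed.

End Coordinates.

Section Minimal.
Variable pt : forall j, C2 R (val (tag j)) -> Zcube (val (tag j)) -> set X.
Arguments pt : clear implicits.
Hypothesis ptP : coordinates chi pt.

Local Notation z0 := (fun=> false).

(* The idempotents [a] whose left ideals are minimal, in coordinates chosen so
   that [a] forgets the label of the orbit and keeps the position in it. *)
Definition adapted (pt : forall j, C2 R (val (tag j)) -> Zcube (val (tag j)) -> set X)
    (a : superextension X) :=
  (forall A, [\/ action a A = set0, action a A = setT |
     exists j (c : C2 R (val (tag j))), action a A = pt j c z0]) /\
  forall j c z, action a (pt j c z) = pt j c z0.

Lemma adapted_retraction : exists m, adapted pt m /\ principal_left_ideal e m.
Proof.
have [m [me mw]] := extend_retraction ptP (fun j => (fun=> 1, fun=> z0) : W j).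
have mpt j c z : action m (pt j c z) = pt j c z0 by rewrite (action_pt ptP) mw mul1g.
exists m; split=> //; split=> // A.
rewrite ((principal_retractionP ptP m).1 me).
case: (retraction_cases ptP A) => [->|->|[j [c [z ->]]]].
- by constructor 1; rewrite action0.
- by constructor 2; rewrite actionT.
- by constructor 3; exists j, c; rewrite mpt.
Qed.

(** [l] moves orbit [z] by [q j z], [m] erases the label, and [b] divides by [q j z0]. If
    [l = l * m], then [l] ignores labels, so [q j] is constant and no discrepancy [p] remains. *)
Lemma adapted_correction m l : adapted pt m ->
  exists b, exists p : forall j, Zcube (val (tag j)) -> C2 R (val (tag j)),
  [/\ forall j, p j z0 = 1,
      forall j c z, action (b * m * l) (pt j c z) = pt j (p j z * c) z0,
      forall A, [\/ action (b * m * l) A = set0, action (b * m * l) A = setT |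
        exists j (c : C2 R (val (tag j))), action (b * m * l) A = pt j c z0] &
      l = l * m -> forall j z, p j z = 1].
Proof.
move=> [mV mpt]; pose q j z := (wreath_of ptP l j).1 z.
have [b [_ bw]] := extend_retraction ptP (fun j => (fun=> (q j z0)^-1, id) : W j).
have bpt j c z : action b (pt j c z) = pt j ((q j z0)^-1 * c) z by rewrite (action_pt ptP) bw.
exists b, (fun j z => (q j z0)^-1 * q j z); split=> [j|j c z|A|lm j z].
- by rewrite mulVg.
- by rewrite !actionM (action_pt ptP l) mpt bpt mulgA.
- rewrite !actionM; case: (mV (action l A)) => [->|->|[j [c ->]]].
  + by constructor 1; rewrite action0.
  + by constructor 2; rewrite actionT.
  + by constructor 3; exists j, ((q j z0)^-1 * c); rewrite bpt.
- suff -> : q j z = q j z0 by rewrite mulVg.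
  have [_ _ ptI _] := ptP; have : action l (pt j 1 z) = action l (pt j 1 z0).
    by rewrite lm !actionM !mpt.
  by rewrite !(action_pt ptP l) !mulg1 => /ptI [].
Qed.

(** For [y] in a left ideal inside that of [m], the corrected product [b * m * y] has the wreath
    coordinates of [m], so it is [m]. *)
Lemma minimal_left_ideal_exists :
  exists m : superextension X, minimal_left_ideal (principal_left_ideal m).
Proof.
have [m [am me]] := adapted_retraction; exists m; split.
  exact: principal_left_ideal_left.
move=> J [[y Jy] JM] JL; apply/seteqP; split=> // _ [s _ <-].
have [t _ ty] := JL _ Jy; have [b [p [_ bpt bV pm]]] := adapted_correction y am.
have mm : m * m = m.
  apply: action_inj; apply/funext => A; rewrite actionM.
  case: (am.1 A) => [->|->|[j [c ->]]]; [by rewrite action0|by rewrite actionT|exact: am.2].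
have {}pm : forall j z, p j z = 1 by apply: pm; rewrite -ty -mulgA mm.
suff <- : b * m * y = m by rewrite mulgA; exact: JM.
have [s' _ s'm] := me; apply: (wreath_of_inj (ptP := ptP)) => //.
  by exists (b * m * t * s') => //; rewrite -ty -s'm !mulgA.
move=> j; transitivity ((fun=> 1, fun=> z0) : W j).
  by apply: wreath_ofP => z; rewrite bpt pm mulg1.
by apply/esym/wreath_ofP => z; rewrite am.2.
Qed.

(** For [l] in [L], the element [b * m * l] collapses blocks to single orbits but moves orbit [z] by
    [p j z]. Dividing the positions in orbit [z] by [p j z] makes it adapted. *)
Lemma minimal_adapted (L : set (superextension X)) : minimal_left_ideal L ->
  exists pt' a, [/\ coordinates chi pt', adapted pt' a, a * a = a &
    L = principal_left_ideal a].
Proof.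
move=> minL; have [[[l Ll] LM] _] := minL; have [m [am _]] := adapted_retraction.
have [b [p [p0 bpt bV _]]] := adapted_correction l am.
have [ptS ptJ ptI ptB] := ptP.
pose pt' j c z := pt j (c * (p j z)^-1) z.
have pt'0 j c : pt' j c z0 = pt j c z0 by rewrite /pt' p0 divg1.
pose a := b * m * l.
have apt j c z : action a (pt' j c z) = pt' j c z0.
  by rewrite bpt C2_comm mulgVK pt'0.
have aV A : [\/ action a A = set0, action a A = setT |
    exists j (c : C2 R (val (tag j))), action a A = pt' j c z0].
  case: (bV A) => [aA|aA|[j [c aA]]]; [by constructor 1|by constructor 2|].
  by constructor 3; exists j, c; rewrite pt'0.
exists pt', a; split=> //.
- split=> [j c z x|j c z j' c' z'|j c z c' z'|j A].
  + by rewrite /pt' ptS mulgA.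
  + exact: ptJ.
  + by move=> /ptI [cc zz]; split=> //; move: cc; rewrite zz => /mulIg.
  + split=> [/ptB [c [z ->]]|[c [z ->]]]; last by apply/ptB; exists (c * (p j z)^-1), z.
    by exists (c * p j z), z; rewrite /pt' mulgK.
- apply: action_inj; apply/funext => A; rewrite actionM.
  by case: (aV A) => [->|->|[j [c ->]]]; [rewrite action0|rewrite actionT|exact: apt].
- by apply: minimal_left_ideal_principal => //; exact: LM.
Qed.

End Minimal.

Section LeftGroup.
Variable pt : forall j, C2 R (val (tag j)) -> Zcube (val (tag j)) -> set X.
Arguments pt : clear implicits.
Hypothesis ptP : coordinates chi pt.
Variable a : superextension X.
Hypothesis adapted_a : adapted pt a.
Hypothesis aa : a * a = a.
Local Notation z0 := (fun=> false).
Local Notation L := (principal_left_ideal a).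

Lemma principal_idempotentP u : L u <-> u * a = u.
Proof. by split=> [[s _ <-]|<-]; [rewrite -mulgA aa|exists u]. Qed.

Definition left_group_coord u j : C2 R (val (tag j)) * left_zero_sg (Zcube (val (tag j))) :=
  ((wreath_of ptP u j).1 z0, (wreath_of ptP u j).2 z0).

Lemma action_left_group u j c z : L u ->
  action u (pt j c z) = pt j ((left_group_coord u j).1 * c) (left_group_coord u j).2.
Proof.
by move=> /principal_idempotentP {1}<-; rewrite actionM adapted_a.2 (action_pt ptP).
Qed.

Lemma left_group_coordP u j c z :
  action u (pt j 1 z0) = pt j c z -> left_group_coord u j = (c, z).
Proof.
have [_ _ ptI _] := ptP; rewrite (action_pt ptP) mulg1 => /ptI [uc uz].
by rewrite /left_group_coord uc uz.
Qed.

(** Since [u = u * a], [u] ignores the label produced by [v] and imposes its own, while positions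
    multiply: hence the left zero factor. *)
Lemma left_group_coordM u v j : L u -> L v ->
  left_group_coord (u * v) j = left_group_coord u j * left_group_coord v j.
Proof.
move=> Lu Lv; apply: left_group_coordP.
by rewrite actionM !action_left_group // mulg1.
Qed.

Lemma left_group_coord_inj u v : L u -> L v ->
  (forall j, left_group_coord u j = left_group_coord v j) -> u = v.
Proof.
move=> Lu Lv uv; apply: action_inj; apply/funext => A.
rewrite -((principal_idempotentP u).1 Lu) -((principal_idempotentP v).1 Lv) !actionM.
case: (adapted_a.1 A) => [->|->|[j [c ->]]]; rewrite ?action0 ?actionT //.
by rewrite !action_left_group // uv.
Qed.

Lemma left_group_coord_surj
    (w : forall j, (C2 R (val (tag j)) * left_zero_sg (Zcube (val (tag j))))%type) :
  exists u, L u /\ forall j, left_group_coord u j = w j.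
Proof.
have [u [_ uw]] := extend_retraction ptP (fun j => (fun=> (w j).1, fun=> (w j).2) : W j).
exists (u * a); split=> [|j]; first by exists u.
rewrite [RHS]surjective_pairing; apply: left_group_coordP.
by rewrite actionM adapted_a.2 (action_pt ptP) uw mulg1.
Qed.

Lemma left_group_isomorphic : isomorphic L
  [set: qpower R X (fun k => (C2 R k * left_zero_sg (Zcube k))%type)].
Proof.
pose F u : qpower R X (fun k => (C2 R k * left_zero_sg (Zcube k))%type) :=
  fun k q => left_group_coord u (existT _ k q).
exists F; split; first split=> //.
- move=> u v /set_mem Lu /set_mem Lv uv; apply: left_group_coord_inj => // -[k q].
  exact: (congr1 (fun f => f k q) uv).
- move=> f _; have [u [Lu uf]] := left_group_coord_surj (fun j => f (tag j) (tagged j)).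
  exists u => //; apply: functional_extensionality_dep => k.
  by apply: functional_extensionality_dep => q; rewrite /F uf.
- move=> u v Lu Lv; apply: functional_extensionality_dep => k.
  by apply: functional_extensionality_dep => q; rewrite /F left_group_coordM.
Qed.

End LeftGroup.
End Algebra.

(** For the idempotent [g], [G] lies in the minimal left ideal of [g]. There [x = g * x] forces [x]
    to have the labels of [g]; conversely all elements with these labels form a group, contained in
    [G] by maximality. Its remaining coordinates are free. *)
Lemma maximal_subgroup_isomorphic (R : realType) (X : groupType) (S : semigroupType)
    (M G : set S) (m : S) :
  minimal_ideal M -> maximal_subgroup M G ->
  minimal_left_ideal (principal_left_ideal m) ->
  (forall L : set S, minimal_left_ideal L -> isomorphic L
     [set: qpower R X (fun k => (C2 R k * left_zero_sg (Zcube k))%type)]) ->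
  isomorphic G [set: qpower R X (fun k => C2 R k)].
Proof.
move=> minM [g [Mg gg [[g' [Gg' GM g'1 GV]] sGM Gg] maxG]] minm isoL.
have g'E : g' = g.
  have [y [Gy gy yg]] := GV _ Gg; rewrite -yg -[in LHS]gg mulgA yg.
  by have [] := g'1 _ Gg.
have minL := minimal_ideal_left minM minm Mg; set L := principal_left_ideal g in minL.
have [F [[_ FI FS] FM]] := isoL L minL.
have Lg : L g by exists g.
have LgP x : L x -> x * g = x by move=> [s _ <-]; rewrite -mulgA gg.
have LM x y : L y -> L (x * y) by have [[_ LM] _] := minL; exact: LM.
have Finj x y : L x -> L y -> F x = F y -> x = y.
  by move=> Lx Ly; apply: FI; rewrite inE.
have MM x : L x -> M x by move=> [s _ <-]; have [[_ MM] _] := minM; have [] := MM s _ Mg.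
pose P : set S := [set x | L x /\ forall k q, (F x k q).2 = (F g k q).2].
have Fg1 k q : (F g k q).1 = 1.
  have := congr1 (fun f => (f k q).1) (FM g g Lg Lg); rewrite gg /= => Fgg.
  by apply: (@mulgI _ (F g k q).1); rewrite mulg1 [RHS]Fgg.
have GP x : G x -> P x.
  move=> Gx; have Lx : L x.
    by exists x => //; have [_] := g'1 _ Gx; rewrite g'E.
  split=> // k q; have := congr1 (fun f => (f k q).2) (FM g x Lg Lx).
  by have [gx _] := g'1 _ Gx; rewrite g'E in gx; rewrite gx.
have PG : P `<=` G.
  apply: maxG; last by [].
  - exists g; split=> [//|x y [Lx xg] [Ly yg]|x [Lx xg]|x [Lx xg]].
    + by split=> [|k q]; [exact: LM|rewrite FM // -xg].
    + split; last exact: LgP.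
      apply: Finj => //; first exact: LM.
      rewrite FM //; apply: functional_extensionality_dep => k.
      apply: functional_extensionality_dep => q.
      rewrite [RHS]surjective_pairing [LHS]surjective_pairing xg; congr pair.
      exact: etrans (congr1 (fun c => c * _) (Fg1 k q)) (mul1g _).
    + have [y Ly yE] := FS (fun k q => ((F x k q).1^-1, (F g k q).2)) I.
      exists y; split.
      * by split=> // k q; rewrite yE.
      * apply: Finj => //; first exact: LM.
        rewrite FM // yE; apply: functional_extensionality_dep => k.
        apply: functional_extensionality_dep => q.
        rewrite [RHS]surjective_pairing Fg1 -xg; congr pair; exact: mulgV.
      * apply: Finj => //; first exact: LM.
        rewrite FM // yE; apply: functional_extensionality_dep => k.
        apply: functional_extensionality_dep => q.
        rewrite [RHS]surjective_pairing Fg1; congr pair; exact: mulVg.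
  - by move=> x [Lx _]; exact: MM.
have {GP PG} -> : G = P by apply/seteqP; split.
exists (fun x => (fun k q => (F x k q).1) : qpower R X (fun k => C2 R k)); split; first split.
- by [].
- move=> x y /set_mem [Lx xg] /set_mem [Ly yg] xy; apply: Finj => //.
  apply: functional_extensionality_dep => k; apply: functional_extensionality_dep => q.
  rewrite [RHS]surjective_pairing [LHS]surjective_pairing xg yg; congr pair.
  exact: (congr1 (fun f => f k q) xy).
- move=> f _; have [x Lx xE] := FS (fun k q => (f k q, (F g k q).2)) I.
  exists x; last by rewrite xE.
  by split=> // k q; rewrite xE.
- move=> x y [Lx _] [Ly _]; rewrite FM //.
Qed.

Lemma prod_topology_continuous (I : Type) (T : topologicalType) (K : I -> topologicalType)
    (f : T -> prod_topology K) :
  (forall i, continuous (fun t => f t i)) -> continuous f.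
Proof.
move=> fc t; apply/cvg_sup => i.
exact: (@continuous_comp_initial _ _ _ (fun g : forall i, K i => g i) f).
Qed.

Lemma prod_topology_proj (I : Type) (T : topologicalType) (K : I -> topologicalType)
    (f : T -> prod_topology K) (i : I) :
  continuous f -> continuous (fun t => f t i).
Proof.
move=> fc t; apply: (@continuous_comp _ _ _ f (fun g => g i)); first exact: fc.
exact: (@proj_continuous {classic I} K i).
Qed.

(** * Topology *)

Section QCube.
Variables (R : realType) (X : groupType).
Local Notation index := (cogroup_index R X).

(** Merges the separate factors of the cube for finite and infinite exponents into one family over
    [index]. *)
Definition qcube_coord (t : qcube R X) (j : index) : half_index (val (tag j)) -> bool :=
  match j with existT (exist k pk) q =>
    match k return forall pk : exponent_pos k,
        qset X (C2 R (val (exist (fun k => exponent_pos k) k pk))) -> half_index k -> bool with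
    | Fin n => fun pn q => t.2 (exist _ n pn) q
    | Infty => fun _ q => t.1 q
    end pk q
  end.

Arguments qcube_coord t j _ : clear implicits.

Definition qcube_of (v : forall j : index, half_index (val (tag j)) -> bool) : qcube R X :=
  (fun q => v (existT _ (exist _ Infty isT) q),
   fun k q => v (existT _ (exist _ (Fin (val k)) (valP k)) q)).

Lemma qcube_ofK v j : qcube_coord (qcube_of v) j = v j.
Proof.
case: j => -[[n|] pk] q /=.
  by move: (valP _) => /= pk'; rewrite (bool_irrelevance pk' pk).
by rewrite (bool_irrelevance pk isT).
Qed.

Lemma qcube_coordK t : qcube_of (qcube_coord t) = t.
Proof.
case: t => t1 t2; congr pair.
apply: functional_extensionality_dep => -[n pn]; apply: functional_extensionality_dep => q /=.
by move: (valP _) => /= p; rewrite (bool_irrelevance p pn).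
Qed.

Lemma qcube_coord_continuous j i : continuous (fun t => qcube_coord t j i : bool).
Proof.
case: j i => -[[n|] pk] q i /=.
  apply: (@prod_topology_proj _ _ _ (fun t : qcube R X => t.2 (exist _ n pk) q) i).
  apply: (@prod_topology_proj _ _ _ (fun t : qcube R X => t.2 (exist _ n pk)) q).
  apply: (@prod_topology_proj _ _ _ (fun t : qcube R X => t.2) (exist _ n pk)).
  by move=> t; exact: cvg_snd.
apply: (@prod_topology_proj _ _ _ (fun t : qcube R X => t.1 q) i).
apply: (@prod_topology_proj _ _ _ (fun t : qcube R X => t.1) q).
by move=> t; exact: cvg_fst.
Qed.

Lemma qcube_of_continuous (T : topologicalType)
    (f : T -> forall j : index, half_index (val (tag j)) -> bool) :
  (forall j i, continuous (fun t => f t j i : bool)) -> continuous (qcube_of \o f).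
Proof.
move=> fc.
have c1 : continuous (fun t => (qcube_of (f t)).1).
  apply: prod_topology_continuous => q; apply: prod_topology_continuous => i.
  exact: (fc (existT _ (exist _ Infty isT) q)).
have c2 : continuous (fun t => (qcube_of (f t)).2).
  apply: prod_topology_continuous => k; apply: prod_topology_continuous => q.
  apply: prod_topology_continuous => i.
  exact: (fc (existT _ (exist _ (Fin (val k)) (valP k)) q)).
by move=> t; exact: cvg_pair (c1 t) (c2 t).
Qed.

End QCube.
Arguments qcube_coord {R X} t j _.

(** * Minimal left ideals as Cantor cubes *)

Section Homeomorphism.
Variables (R : realType) (X : groupType).
Hypothesis abelianX : forall x y : X, commute x y.
Local Notation index := (cogroup_index R X).
Implicit Types (j : index) (A B : set X) (x y : X) (u v : superextension X).

Variable chi : forall j, X -> C2 R (val (tag j)).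
Hypothesis chiM : forall j x y, chi j (x * y) = chi j x * chi j y.
Hypothesis chiS : forall j c, exists x, chi j x = c.

(* A set in [block chi j] is determined by its trace on the points [s j i],
   which is arbitrary. *)
Lemma block_half_coord :
  exists (s : forall j, half_index (val (tag j)) -> X)
         (idx : forall j, X -> half_index (val (tag j))) (sg : forall j, X -> bool),
  (forall j A, block chi j A -> forall y, `[< A y >] = `[< A (s j (idx j y)) >] (+) sg j y) /\
  (forall j f, exists A, block chi j A /\ forall i, `[< A (s j i) >] = f i).
Proof.
have ex j : exists sd : (half_index (val (tag j)) -> X) *
    ((X -> half_index (val (tag j))) * (X -> bool)),
  (forall A, block chi j A -> forall y,
     `[< A y >] = `[< A (sd.1 (sd.2.1 y)) >] (+) sd.2.2 y) /\
  (forall f, exists A, block chi j A /\ forall i, `[< A (sd.1 i) >] = f i).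
  have [d [idx [sg [cE idxd sgd idxN sgN]]]] := C2_half_coord R (tag j).
  have [s sE] := choice (fun i => @chiS j (d i)).
  have [n nN] := chiS (C2N1 R (tag j)).
  exists (s, (idx \o chi j, sg \o chi j)); split=> /= [A jA y|f].
    have ker x x' : chi j x = chi j x' -> `[< A x >] = `[< A x' >].
      by move=> xx; apply: asbool_equiv_eq; split; apply: (block_kernel chiM chiS jA).
    have := cE (chi j y); case: (sg _) => yE; last first.
      by rewrite addbF; apply: ker; rewrite sE.
    rewrite addbT -asbool_neg (_ : (~ _) = shift n A (s (idx (chi j y)))); last first.
      by rewrite (jA n nN).
    by apply: ker; rewrite chiM nN sE.
  exists [set y | f (idx (chi j y)) (+) sg (chi j y)]; split=> [x xN|i].
    apply/funext => y; rewrite /shift /= chiM xN idxN sgN addbN.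
    by apply/propext; split=> /negP.
  by rewrite /= sE idxd sgd addbF asboolb.
exists (fun j => (projT1 (cid (ex j))).1), (fun j => (projT1 (cid (ex j))).2.1),
  (fun j => (projT1 (cid (ex j))).2.2).
by split=> j; have [] := projT2 (cid (ex j)).
Qed.

Variable e : superextension X.
Hypothesis eP : retraction chi (action e).
Variable pt : forall j, C2 R (val (tag j)) -> Zcube (val (tag j)) -> set X.
Arguments pt : clear implicits.
Hypothesis ptP : coordinates chi pt.
Variable a : superextension X.
Hypothesis adapted_a : adapted pt a.
Hypothesis aa : a * a = a.
Local Notation z0 := (fun=> false).
Local Notation L := (principal_left_ideal a).

Lemma superextension_bit_continuous A :
  continuous (fun u : superextension X => `[< val u A >] : bool).
Proof.
apply: (@prod_topology_proj _ _ _ (fun u : superextension X => family_indicator (val u)) A).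
move=> u; apply: (@continuous_comp _ _ _ (fun u : superextension X => val u : families X)
  (@family_indicator X)); first exact: initial_continuous.
exact: initial_continuous.
Qed.

Lemma continuous_superextension (T : topologicalType) (f : T -> superextension X) :
  (forall A, continuous (fun t => `[< val (f t) A >] : bool)) -> continuous f.
Proof.
move=> fc; apply: continuous_comp_initial; apply: continuous_comp_initial.
by apply: prod_topology_continuous => A; exact: fc.
Qed.

(** As [u = u * a], [u] is determined by its values on the sets [base j], which are arbitrary
    members of the blocks; their traces on the points [s j i] are the coordinates of the cube. *)
Lemma left_group_homeomorphic : homeomorphic (set_type L) (qcube R X).
Proof.
have [s [idx [sg [blockE blockS]]]] := block_half_coord.
have [ptS _ _ ptB] := ptP.
pose base j := pt j 1 z0.
have baseB u j : block chi j (action u (base j)).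
  move=> x xN; apply: natural_twin (action_natural u) _.
  by apply: (ptB j _).2 xN; exists 1, z0.
pose bits u j i : bool := `[< action u (base j) (s j i) >].
have bits_inj u v : L u -> L v -> (forall j i, bits u j i = bits v j i) -> u = v.
  move=> Lu Lv uv; apply: (left_group_coord_inj chiS (ptP := ptP) adapted_a aa) => // j.
  rewrite [RHS]surjective_pairing; apply: (left_group_coordP chiS).
  have -> : action u (pt j 1 z0) = action v (pt j 1 z0).
    apply/funext => y; apply/propext; apply: asbool_eq_equiv.
    rewrite (blockE _ _ (baseB u j)) (blockE _ _ (baseB v j)).
    by congr addb; exact: uv.
  by rewrite (action_left_group chiS ptP adapted_a aa) // mulg1.
have exu (t : qcube R X) : exists u : set_type L, forall j, bits (val u) j = qcube_coord t j.
  have exc j : exists cz : C2 R (val (tag j)) * left_zero_sg (Zcube (val (tag j))),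
      forall i, `[< pt j cz.1 cz.2 (s j i) >] = qcube_coord t j i.
    have [A [/ptB [c [z ->]] Av]] := blockS j (qcube_coord t j).
    by exists (c, z).
  have [u [Lu uE]] := left_group_coord_surj abelianX chiS eP ptP adapted_a
    (fun j => projT1 (cid (exc j))).
  exists (exist _ u (mem_set Lu)) => j; apply/funext => i.
  rewrite /bits /base /= (action_left_group chiS ptP adapted_a aa) // uE mulg1.
  exact: projT2 (cid (exc j)) i.
have [g gE] := choice exu.
have LP (u : set_type L) : L (val u) by exact: set_mem (valP u).
exists (fun u : set_type L => qcube_of (bits (val u))), g; split.
- move=> u; apply: val_inj; apply: bits_inj => // j i.
  by rewrite gE qcube_ofK.
- by move=> t; rewrite -[RHS]qcube_coordK; congr qcube_of;
    apply: functional_extensionality_dep => j; exact: gE.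
- apply: qcube_of_continuous => j i u.
  apply: (@continuous_comp _ _ _ (fun u : set_type L => val u : superextension X)
    (fun u : superextension X => `[< val u (shift (s j i) (base j)) >] : bool)).
    exact: initial_continuous.
  exact: superextension_bit_continuous.
- apply: continuous_comp_initial; apply: continuous_superextension => A.
  have gA t : `[< val (val (g t)) A >] = `[< action (val (g t)) (action a A) 1 >].
    by rewrite -actionM ((principal_idempotentP aa _).1 (LP _)) -valE.
  have cst_continuous (b : bool) : (forall t, `[< val (val (g t)) A >] = b) ->
      continuous (fun t => `[< val (val (g t)) A >] : bool).
    move=> gb; rewrite (_ : (fun t => _) = fun=> b); last exact/funext.
    by move=> t; exact: cvg_cst.
  (* Membership of [A] depends on [t] only through [action a A]: it is constant, or, for a translate
     of [base j], one coordinate of [t] up to a fixed sign. *)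
  case: (adapted_a.1 A) => [aA|aA|[j [c aA]]].
  + apply: (cst_continuous false) => t.
    by rewrite gA aA action0 asboolF.
  + apply: (cst_continuous true) => t.
    by rewrite gA aA actionT asboolT.
  + have [x xc] := chiS c.
    have gx t : `[< val (val (g t)) A >] = qcube_coord t j (idx j x) (+) sg j x.
      rewrite gA aA -[c]mulg1 -xc -ptS; have [-> _ _] := action_natural (val (g t)).
      by rewrite -gE /shift /= mulg1 (blockE _ _ (baseB _ j)).
    rewrite (_ : (fun t => _) = (addb^~ (sg j x)) \o (fun t => qcube_coord t j (idx j x)));
      last exact/funext.
    move=> t; apply: continuous_comp; first exact: qcube_coord_continuous.
    move=> U /nbhs_singleton Ub; apply: filterS (discrete_set1 _) => _ ->.
    exact: Ub.
Qed.

End Homeomorphism.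

Theorem theorem19p2 (R : realType) (X : groupType)
    (abelianX : forall x y : X, commute x y) :
  (forall M G : set (superextension X),
     minimal_ideal M -> maximal_subgroup M G ->
     isomorphic G [set: qpower R X (fun k => C2 R k)])
  /\
  (forall L : set (superextension X), minimal_left_ideal L ->
     homeomorphic (set_type L) (qcube R X) /\
     isomorphic L [set: qpower R X (fun k => (C2 R k * left_zero_sg (Zcube k))%type)])
  /\
  (exists x : superextension X,
     isomorphic (principal_left_ideal x)
       [set: qpower R X (fun k => wreath (C2 R k) (Zcube k))]).
Proof.
have [chi [chiM chiS chiK chiI chiE]] := index_characters R abelianX.
have [pt ptP] := coordinates_exist abelianX chiM chiS chiK chiI.
have [f fP] := retraction_exists abelianX chiM chiS chiK chiI chiE.
have [nf _ _] := fP; have [e eE] := action_surj nf; rewrite -eE in fP.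
have leftL (L : set (superextension X)) : minimal_left_ideal L ->
    homeomorphic (set_type L) (qcube R X) /\
    isomorphic L [set: qpower R X (fun k => (C2 R k * left_zero_sg (Zcube k))%type)].
  move=> /(minimal_adapted abelianX chiS fP ptP) [pt' [a [pt'P aP aa ->]]]; split.
    exact: (left_group_homeomorphic abelianX chiM chiS fP pt'P aP aa).
  exact: (left_group_isomorphic abelianX chiS fP pt'P aP aa).
split; last split=> //.
  move=> M G mM mG; have [m minm] := minimal_left_ideal_exists abelianX chiS fP ptP.
  by apply: (maximal_subgroup_isomorphic mM mG minm) => L /leftL [].
by exists e; exact: (principal_wreath abelianX chiS fP ptP).
Qed.
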